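(* Let $n\ge 1$ and $m\in\mathbb{N}$. For every tuple $\bar g=(g_1,\dots,g_m)$ of polynomials $g_i\in\mathbb{R}[\bar X]$ such that the quadratic module $M(\bar g)$ is archimedean and $\emptyset\neq S(\bar g)\subseteq(-1,1)^n$, there is some $c\in\mathbb{R}_{>0}$ (depending on $\bar g$) such that for all $f\in\mathbb{R}[\bar X]$ of degree $d$ with $$f^\ast:=\min\{f(x)\mid x\in S(\bar g)\}>0,$$ we have $$f\in M\left(\bar g,\;c\exp\left(\left(d^2n^d\frac{\|f\|}{f^\ast}\right)^c\right)\right).$$
   Context: $\mathbb{N}=\{0,1,2,\dots\}$. $\mathbb{R}[\bar X]$ is the ring of real polynomials in $n\ge 1$ indeterminates $\bar X=(X_1,\dots,X_n)$, and $\sum\mathbb{R}[\bar X]^2$ is the set of (finite) sums of squares of polynomials in $\mathbb{R}[\bar X]$. For a tuple $\bar g=(g_1,\dots,g_m)$ of polynomials put $g_0:=1$ and $$S(\bar g):=\{x\in\mathbb{R}^n\mid g_1(x)\ge 0,\dots,g_m(x)\ge 0\},\qquad M(\bar g):=\left\{\sum_{i=0}^m\sigma_ig_i\;\middle|\;\sigma_i\in\sum\mathbb{R}[\bar X]^2\right\}.$$ $M(\bar g)$ is called the quadratic module generated by $\bar g$. It is archimedean if $N-\sum_{i=1}^nX_i^2\in M(\bar g)$ for some $N\in\mathbb{N}$. For real $k\ge 0$, $$M(\bar g,k):=\left\{\sum_{i=0}^m\sigma_ig_i\;\middle|\;\sigma_i\in\sum\mathbb{R}[\bar X]^2,\ \deg(\sigma_ig_i)\le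 k\text{ for all }i\right\}$$ (the zero polynomial satisfies every such degree bound). For $\alpha\in\mathbb{N}^n$ put $|\alpha|=\alpha_1+\dots+\alpha_n$, $\bar X^\alpha=X_1^{\alpha_1}\cdots X_n^{\alpha_n}$ and $\binom{|\alpha|}{\alpha}=\frac{|\alpha|!}{\alpha_1!\cdots\alpha_n!}$. For $f=\sum_\alpha a_\alpha\bar X^\alpha$ with $a_\alpha\in\mathbb{R}$, the norm is $\|f\|:=\max_\alpha |a_\alpha|/\binom{|\alpha|}{\alpha}$. The degree of a polynomial is its total degree. *)

(* Defs.v *)
From HB Require Import structures.
From mathcomp Require Import all_boot all_order all_algebra.
From mathcomp Require Import classical_sets reals.
From mathcomp Require Import mpoly.
Set Implicit Arguments.
Unset Strict Implicit.
Unset Printing Implicit Defensive.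
Import Order.TTheory GRing.Theory Num.Theory.
Local Open Scope classical_set_scope.
Local Open Scope ring_scope.

Section QuadraticModule.
Variables (R : realType) (n m : nat).
Implicit Types (g : m.-tuple {mpoly R[n]}) (p f : {mpoly R[n]}).

Definition is_sos p : Prop :=
  exists s : seq {mpoly R[n]}, p = \sum_(q <- s) q ^+ 2.

(* g_0 = 1, g_1, ..., g_m : the entry g_i of the mathematical tuple is
   [tnth g (i - 1)]. *)
Definition gens g : m.+1.-tuple {mpoly R[n]} := cons_tuple 1 g.

Definition Sset g : set ('I_n -> R) :=
  [set x | forall i : 'I_m, 0 <= (tnth g i).@[x]].

Definition quadratic_module g : set {mpoly R[n]} :=
  [set p | exists sigma : 'I_m.+1 -> {mpoly R[n]},
     (forall i, is_sos (sigma i)) /\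
     p = \sum_(i < m.+1) sigma i * tnth (gens g) i].

Definition archimedean g : Prop :=
  exists N : nat, quadratic_module g (N%:R - \sum_(i < n) 'X_i ^+ 2).

(* [msize p] is the total degree plus one, and [msize 0 = 0]. *)
Definition degree_le p (k : R) : Prop :=
  p = 0 \/ (msize p).-1%:R <= k.

Definition truncated_quadratic_module g (k : R) : set {mpoly R[n]} :=
  [set p | exists sigma : 'I_m.+1 -> {mpoly R[n]},
     [/\ forall i, is_sos (sigma i),
         forall i, degree_le (sigma i * tnth (gens g) i) k
       & p = \sum_(i < m.+1) sigma i * tnth (gens g) i]].

Definition multinomial_coef (a : 'X_{1..n}) : R :=
  (mdeg a)`!%:R / (\prod_(i < n) (a i)`!)%:R.

(* Coefficients outside [msupp f] vanish, so the maximum over all exponents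
   is the maximum over the support (and 0 for the zero polynomial). *)
Definition mpoly_norm f : R :=
  \big[Num.max/0]_(a <- msupp f) (`|f@_a| / multinomial_coef a).

Definition is_minimum (A : set R) (v : R) : Prop := A v /\ lbound A v.

End QuadraticModule.

(* Main.v *)
Require Import Defs.
From HB Require Import structures.
From mathcomp Require Import all_boot all_order all_algebra.
From mathcomp Require Import classical_sets reals sequences exp.
From mathcomp Require Import mpoly.
From mathcomp Require ordered_qelim qe_rcf.
From mathcomp Require Import ring lra zify.
Set Implicit Arguments.
Unset Strict Implicit.
Unset Printing Implicit Defensive.
Import Order.TTheory GRing.Theory Num.Theory.
Local Open Scope classical_set_scope.
Local Open Scope ring_scope.

(** Why a positive polynomial [f] lies in [M(g)] with this degree bound.

    Rescale the constraints to [u_i = g_i / gamma] with [|u_i| <= 1] on the cube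
    [[-1, 1]^n], and subtract from [f] the element
    [lambda sum_i (1 - u_i) ^ (2 k) u_i] of [M(g)]. Where all constraints hold, the
    subtraction costs at most [lambda m / (2 k)], because
    [(1 - y) ^ (2 k) y <= 1 / (2 k)] for [0 <= y <= 1]. Where some [u_i <= - delta]
    it raises the value by at least [lambda delta]. So if [f >= eps] wherever no
    constraint is violated by [delta], then for suitable [lambda] and [k] the
    difference [h] is at least [eps / 2] on the whole cube ([perturbation]).

    A polynomial that is positive on a cube has nonnegative coefficients in the
    Bernstein basis of large degree ([bernstein_positive]); the degree needed is
    controlled by the degree of [h], the size of its coefficients and its minimum.
    Hence [h] is a nonnegative combination of products of
    the linear polynomials [1 + X_i] and [1 - X_i]. Even powers are squares, so
    only the finitely many products with exponents [0] and [1] have to be in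
    [M(g)], and these have some fixed degree ([faces_qmodule],
    [putinar_bounded]).

    That these products are in [M(g)] is the qualitative theorem, since they are
    positive on [S(g)], which is inside the open cube ([putinar]). It is proved by
    the same argument on a large box [[- a, a]^n]. There all products of
    [a + X_i] and [a - X_i] are in [M(g)] for a simple reason: they are in the
    quadratic module generated by [N - sum_i X_i ^ 2] alone, which is closed under
    products because the square of a single generator is a square
    ([archimedean_box_products]). A direct use of the large box would not give the
    bound, as the values of [f] there can exceed those on the unit cube by a
    factor exponential in the degree.

    For the quantitative statement one needs [delta] to be polynomial in
    [f* / (d ^ 2 n ^ d |f|)]. A point of the cube with [f <= f* / 2] is at distance
    at least a multiple of this quotient from [S(g)], by the Lipschitz bound for
    [f]. The Lojasiewicz inequality ([lojasiewicz]) then gives a constraint that is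
    violated by a power of the distance. Its proof is semialgebraic: the pairs
    [(t, s)] such that some point at squared distance [t] violates all constraints
    by at most [s] are defined by a first order formula; by quantifier elimination
    they are given by signs of polynomials in [(t, s)], and those signs are
    constant in a region [0 < s < c t ^ r] ([definable_stable]); compactness shows
    that the formula fails there. With this [delta] the numbers [lambda], [k] and
    the degree of [h] are polynomial in [d ^ 2 n ^ d |f| / f*] up to the scale of
    [f], and the degree of the Bernstein expansion is exponential in them
    ([putinar_degree], [growth]). *)

(** * Bounds on degree and coefficients *)

(** The list of terms need not be reduced, so that bounds for sums, products and
    compositions come without tracking cancellations between terms; this is the
    l1 norm of the coefficients and the degree, both up to an upper bound. *)
Definition l1_bound (R : realType) (n D : nat) (A : R) (p : {mpoly R[n]}) :=
  exists s : seq (R * 'X_{1..n}),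
    [/\ p = \sum_(u <- s) u.1 *: 'X_[u.2],
        forall u, u \in s -> (mdeg u.2 <= D)%N
      & \sum_(u <- s) `|u.1| <= A].

Section L1Bound.
Variables (R : realType) (n : nat).
Implicit Types (p q : {mpoly R[n]}) (A B : R).

Lemma l1_bound_ge0 D A p : l1_bound D A p -> 0 <= A.
Proof. by case=> s [_ _]; apply: le_trans; apply: sumr_ge0. Qed.

Lemma l1_boundW D D' A A' p :
  (D <= D')%N -> A <= A' -> l1_bound D A p -> l1_bound D' A' p.
Proof.
move=> DD AA [s [-> sD sA]]; exists s; split=> //; last exact: le_trans AA.
by move=> u /sD /leq_trans; apply.
Qed.

Lemma l1_bound_mono c m : l1_bound (mdeg m) `|c| (c *: 'X_[m] : {mpoly R[n]}).
Proof.
by exists [:: (c, m)]; split; rewrite ?big_seq1 // => u; rewrite inE => /eqP->.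
Qed.

Lemma l1_boundC c : l1_bound 0 `|c| (c%:MP : {mpoly R[n]}).
Proof.
by have := l1_bound_mono c 0%MM; rewrite mdeg0 mpolyX0 -mul_mpolyC mulr1.
Qed.

Lemma l1_boundX i : l1_bound 1 1 ('X_i : {mpoly R[n]}).
Proof. by have := l1_bound_mono 1 U_(i)%MM; rewrite mdeg1 normr1 scale1r. Qed.

Lemma l1_boundD D A B p q :
  l1_bound D A p -> l1_bound D B q -> l1_bound D (A + B) (p + q).
Proof.
move=> [s [-> sD sA]] [t [-> tD tB]]; exists (s ++ t); rewrite !big_cat /=.
split=> //; last exact: lerD.
by move=> u; rewrite mem_cat => /orP[/sD|/tD].
Qed.

Lemma l1_boundZ D A c p : l1_bound D A p -> l1_bound D (`|c| * A) (c *: p).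
Proof.
move=> [s [-> sD sA]]; exists [seq (c * u.1, u.2) | u <- s]; split.
- by rewrite scaler_sumr big_map; apply: eq_bigr => u _; rewrite scalerA.
- by move=> u /mapP[v /sD vD ->].
- rewrite big_map /=; under eq_bigr do rewrite normrM.
  by rewrite -mulr_sumr ler_wpM2l.
Qed.

Lemma l1_boundM D E A B p q :
  l1_bound D A p -> l1_bound E B q -> l1_bound (D + E) (A * B) (p * q).
Proof.
move=> bp bq; have A0 := l1_bound_ge0 bp; move: bp bq.
move=> [s [-> sD sA]] [t [-> tE tB]].
exists [seq (u.1 * v.1, (u.2 + v.2)%MM) | u <- s, v <- t]; split.
- rewrite big_allpairs_dep mulr_suml; apply: eq_bigr => u _.
  rewrite mulr_sumr; apply: eq_bigr => v _.
  by rewrite mpolyXD -scalerAl -scalerAr scalerA.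
- move=> _ /allpairsP[[u v] /= [/sD uD /tE vE ->]] /=.
  by rewrite mdegD leq_add.
- rewrite big_allpairs_dep /=.
  have -> : \sum_(u <- s) \sum_(v <- t) `|u.1 * v.1| =
      (\sum_(u <- s) `|u.1|) * \sum_(v <- t) `|v.1|.
    rewrite mulr_suml; apply: eq_bigr => u _; rewrite mulr_sumr.
    by apply: eq_bigr => v _; rewrite normrM.
  by apply: ler_pM => //; apply: sumr_ge0.
Qed.

Lemma l1_boundXn D A p k : l1_bound D A p -> l1_bound (k * D) (A ^+ k) (p ^+ k).
Proof.
move=> bp; elim: k => [|k IH].
  by rewrite !expr0 -mpolyC1 mul0n -[X in l1_bound _ X]normr1; apply: l1_boundC.
by rewrite !exprS mulSn; apply: l1_boundM.
Qed.

Lemma l1_bound_sum (I : Type) (r : seq I) (F : I -> {mpoly R[n]}) D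
    (A : I -> R) :
  (forall i, l1_bound D (A i) (F i)) ->
  l1_bound D (\sum_(i <- r) A i) (\sum_(i <- r) F i).
Proof.
move=> bF; elim: r => [|i r IH]; last by rewrite !big_cons; apply: l1_boundD.
by exists [::]; rewrite !big_nil; split.
Qed.

Lemma l1_bound_msupp p :
  l1_bound (msize p).-1 (\sum_(m <- msupp p) `|p@_m|) p.
Proof.
exists [seq (p@_m, m) | m <- msupp p]; split=> [|u|]; last by rewrite big_map.
  by rewrite big_map {1}[p]mpolyE.
move=> /mapP[m mp ->] /=; have := msize_mdeg_lt mp.
by case: (msize p) => //= k; rewrite ltnS.
Qed.

Lemma l1_bound_ex p : exists D A, l1_bound D A p.
Proof. by do 2 eexists; apply: l1_bound_msupp. Qed.

Lemma norm_monomial_le1 (m : 'X_{1..n}) (x : 'I_n -> R) :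
  (forall i, `|x i| <= 1) -> `|\prod_i x i ^+ m i| <= 1.
Proof.
move=> x1; rewrite normr_prod; apply: prodr_ile1 => i _.
by rewrite normrX exprn_ge0 //= exprn_ile1.
Qed.

Lemma l1_bound_eval D A p (x : 'I_n -> R) :
  l1_bound D A p -> (forall i, `|x i| <= 1) -> `|p.@[x]| <= A.
Proof.
move=> [s [-> _ sA]] x1; apply: le_trans sA; rewrite raddf_sum.
rewrite (le_trans (ler_norm_sum _ _ _)) //; apply: ler_sum => u _.
rewrite /= mevalZ mevalX normrM -[leRHS]mulr1.
by rewrite ler_wpM2l // norm_monomial_le1.
Qed.

(** One factor is changed at a time; the other one is bounded by [1]. *)
Lemma lipschitz_mul (a b a' b' e f : R) : `|a| <= 1 -> `|b'| <= 1 ->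
  `|a - a'| <= e -> `|b - b'| <= f -> `|a * b - a' * b'| <= e + f.
Proof.
move=> a1 b1 ae bf.
have -> : a * b - a' * b' = (a - a') * b' + a * (b - b') by ring.
rewrite (le_trans (ler_normD _ _)) // !normrM lerD //.
  by rewrite -[e]mulr1 ler_pM.
by rewrite -[f]mul1r ler_pM.
Qed.

Lemma lipschitz_prod (I : Type) (r : seq I) (a b e : I -> R) :
  (forall i, `|a i| <= 1) -> (forall i, `|b i| <= 1) ->
  (forall i, `|a i - b i| <= e i) ->
  `|\prod_(i <- r) a i - \prod_(i <- r) b i| <= \sum_(i <- r) e i.
Proof.
move=> a1 b1 abe; elim: r => [|i r IH].
  by rewrite !big_nil subrr normr0.
rewrite !big_cons; apply: lipschitz_mul => //.
by rewrite normr_prod; apply: prodr_ile1 => j _; rewrite normr_ge0 b1.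
Qed.

Lemma lipschitz_exp (a b e : R) k : `|a| <= 1 -> `|b| <= 1 ->
  `|a - b| <= e -> `|a ^+ k - b ^+ k| <= k%:R * e.
Proof.
move=> a1 b1 abe.
have := @lipschitz_prod _ (index_enum 'I_k) (fun=> a) (fun=> b) (fun=> e).
by rewrite !prodr_const sumr_const !card_ord mulr_natl; apply.
Qed.

(** A monomial of degree [D] is a product of [D] factors bounded by [1], and each
    factor that is moved by [e] moves the product by at most [e]. *)
Lemma lipschitz_monomial (m : 'X_{1..n}) (x y : 'I_n -> R) (e : R) :
  (forall i, `|x i| <= 1) -> (forall i, `|y i| <= 1) ->
  (forall i, `|x i - y i| <= e) ->
  `|\prod_i x i ^+ m i - \prod_i y i ^+ m i| <= (mdeg m)%:R * e.
Proof.
move=> x1 y1 xye; rewrite mdegE natr_sum mulr_suml.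
apply: lipschitz_prod => i; last exact: lipschitz_exp.
  by rewrite normrX exprn_ile1.
by rewrite normrX exprn_ile1.
Qed.

Lemma l1_bound_lipschitz D A p (x y : 'I_n -> R) (e : R) : l1_bound D A p ->
  (forall i, `|x i| <= 1) -> (forall i, `|y i| <= 1) -> 0 <= e ->
  (forall i, `|x i - y i| <= e) -> `|p.@[x] - p.@[y]| <= D%:R * A * e.
Proof.
move=> [s [-> sD sA]] x1 y1 e0 xye.
have : D%:R * (\sum_(u <- s) `|u.1|) * e <= D%:R * A * e.
  by rewrite ler_wpM2r // ler_wpM2l // ler0n.
move=> h; apply: le_trans h.
have sE z : (\sum_(u <- s) u.1 *: 'X_[u.2]).@[z] =
    \sum_(u <- s) u.1 * \prod_i z i ^+ u.2 i.
  by rewrite raddf_sum /=; apply: eq_bigr => u _; rewrite mevalZ mevalX.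
rewrite !sE -sumrB mulr_sumr mulr_suml.
rewrite (le_trans (ler_norm_sum _ _ _)) // big_seq [leRHS]big_seq.
apply: ler_sum => u us; rewrite -mulrBr normrM.
rewrite [_ * `|u.1|]mulrC -mulrA ler_wpM2l //.
rewrite (le_trans (lipschitz_monomial _ x1 y1 xye)) //.
by rewrite ler_wpM2r // ler_nat sD.
Qed.

Lemma l1_bound_prod (I : Type) (r : seq I) (F : I -> {mpoly R[n]})
    (D : I -> nat) (A : I -> R) :
  (forall i, l1_bound (D i) (A i) (F i)) ->
  l1_bound (\sum_(i <- r) D i)%N (\prod_(i <- r) A i) (\prod_(i <- r) F i).
Proof.
move=> bF; elim: r => [|i r IH]; last by rewrite !big_cons; apply: l1_boundM.
by rewrite !big_nil -mpolyC1 -[X in l1_bound _ X]normr1; apply: l1_boundC.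
Qed.

(** Each of the at most [D] factors of a term is replaced by a polynomial whose
    coefficients have total size at most [B]. *)
Lemma l1_bound_comp D A B p (lq : n.-tuple {mpoly R[n]}) : 1 <= B ->
  (forall i, l1_bound 1 B (tnth lq i)) ->
  l1_bound D A p -> l1_bound D (A * B ^+ D) (p \mPo lq).
Proof.
move=> B1 lqB [s [-> sD sA]]; rewrite raddf_sum /=.
have B0 : 0 <= B by rewrite (le_trans _ B1).
apply: (@l1_boundW D _ (\sum_(u <- s) `|u.1| * B ^+ D)) => //.
  by rewrite -mulr_suml ler_wpM2r // exprn_ge0.
rewrite big_seq [X in l1_bound _ _ X]big_seq.
suff h u : u \in s -> l1_bound D (`|u.1| * B ^+ D) ((u.1 *: 'X_[u.2]) \mPo lq).
  rewrite -!big_seq; elim: s {sD sA} h => [|u s IH] h.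
    by exists [::]; rewrite !big_nil; split.
  rewrite !big_cons; apply: l1_boundD; first by apply: h; rewrite inE eqxx.
  by apply: IH => v vs; apply: h; rewrite inE vs orbT.
move=> /sD uD; rewrite comp_mpolyZ comp_mpolyX; apply: l1_boundZ.
have : l1_bound (\sum_i u.2 i)%N (\prod_i B ^+ u.2 i)
    (\prod_i tnth lq i ^+ u.2 i).
  apply: l1_bound_prod => i.
  by rewrite -[X in l1_bound X]muln1; apply: l1_boundXn.
rewrite -mdegE prodrXr -mdegE; apply: l1_boundW => //.
exact: ler_weXn2l.
Qed.

End L1Bound.

(** * The norm and the sum of the coefficients *)

Section NormBound.
Variables (R : realType) (n : nat).
Implicit Types (p q : {mpoly R[n]}).

Let nneg p := forall m, 0 <= p@_m.

Lemma mcoeffM_nneg p q : nneg p -> nneg q -> nneg (p * q).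
Proof.
by move=> p0 q0 m; rewrite mcoeffM sumr_ge0 // => k _; rewrite mulr_ge0.
Qed.

Lemma mcoeff_sumX_exp_nneg k : nneg ((\sum_(i < n) 'X_i) ^+ k).
Proof.
elim: k => [|k IH]; first by move=> m; rewrite expr0 mcoeff1 ler0n.
rewrite exprS; apply: mcoeffM_nneg => // m.
by rewrite raddf_sum sumr_ge0 // => i _; rewrite /= mcoeffX ler0n.
Qed.

Lemma multinomial_coef_gt0 (m : 'X_{1..n}) : 0 < multinomial_coef R m.
Proof.
rewrite divr_gt0 ?ltr0n ?fact_gt0 // prodn_gt0 // => i.
exact: fact_gt0.
Qed.

(** The multinomial theorem, as a lower bound on the coefficients; the induction
    on [k] is the recurrence that removes one factor [X_i]. *)
Lemma multinomial_coef_le k (m : 'X_{1..n}) : mdeg m = k ->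
  multinomial_coef R m <= ((\sum_(i < n) 'X_i) ^+ k : {mpoly R[n]})@_m.
Proof.
elim: k m => [|k IH] m mk.
  have -> : m = 0%MM by apply/eqP; rewrite -mdeg_eq0 mk.
  rewrite expr0 mcoeff1 eqxx /multinomial_coef mdeg0 fact0.
  by rewrite big1 ?divr1 // => i _; rewrite mnm0E fact0.
have k0 : k.+1%:R != 0 :> R by rewrite pnatr_eq0.
have -> : multinomial_coef R m =
    \sum_(i < n) (m i)%:R / k.+1%:R * multinomial_coef R m.
  by rewrite -mulr_suml -mulr_suml -natr_sum -mdegE mk divff ?mul1r.
rewrite exprSr mulr_sumr raddf_sum; apply: ler_sum => i _ /=.
have [mi0|mi] := posnP (m i).
  rewrite mi0 !mul0r; apply: mcoeffM_nneg; first exact: mcoeff_sumX_exp_nneg.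
  by move=> l; rewrite mcoeffX ler0n.
have mE : m = (U_(i) + (m - U_(i)))%MM.
  by rewrite addmC submK // lep1mP -lt0n.
have dk : mdeg (m - U_(i))%MM = k.
  by apply/eqP; rewrite -eqSS -mk {2}mE mdegD mdeg1.
rewrite [in leRHS]mE mcoeffMX (le_trans _ (IH _ dk)) // /multinomial_coef mk dk.
rewrite factS natrM (bigD1 i) //= [in leRHS](bigD1 i) //=.
have -> : \prod_(j < n | j != i) ((m - U_(i))%MM j)`! =
    \prod_(j < n | j != i) (m j)`! :> nat.
  apply: eq_bigr => j ji; rewrite mnmBE mnm1E eq_sym (negPf ji) subn0.
  by [].
rewrite mnmBE mnm1E eqxx subn1 -{2}(prednK mi) factS prednK // !natrM.
have f1 : (m i).-1`!%:R != 0 :> R by rewrite pnatr_eq0 -lt0n fact_gt0.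
have f2 : (m i)%:R != 0 :> R by rewrite pnatr_eq0 -lt0n.
set P := (\prod_(_ < n | _) _)%N.
have f3 : P%:R != 0 :> R.
  by rewrite pnatr_eq0 -lt0n prodn_gt0 // => j; apply: fact_gt0.
rewrite le_eqVlt; apply/orP; left; apply/eqP; field.
by rewrite f1 f2 f3 nat1r k0.
Qed.

Lemma ler_sum_uniq_sub (T : eqType) (s t : seq T) (F : T -> R) :
  uniq s -> uniq t -> {subset s <= t} -> (forall x, 0 <= F x) ->
  \sum_(x <- s) F x <= \sum_(x <- t) F x.
Proof.
move=> us ut st F0; rewrite [leRHS](bigID (mem s)) /= -[leLHS]addr0.
rewrite lerD ?sumr_ge0 // -[X in _ <= X]big_filter le_eqVlt.
apply/orP; left; apply/eqP.
apply: perm_big; apply: uniq_perm; rewrite ?filter_uniq // => x.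
by rewrite mem_filter; apply/idP/andP => [xs|[]//]; split=> //; apply: st.
Qed.

(** The expansions of the powers of [X_1 + ... + X_n], of exponent at most [d],
    are evaluated at [(1, ..., 1)], where they add up to at most
    [(d + 1) n ^ d]. *)
Lemma sum_multinomial_coef (s : seq 'X_{1..n}) d : (0 < n)%N -> uniq s ->
  (forall m, m \in s -> (mdeg m <= d)%N) ->
  \sum_(m <- s) multinomial_coef R m <= d.+1%:R * n%:R ^+ d.
Proof.
move=> n0 us sd; pose P : {mpoly R[n]} := \sum_(k < d.+1) (\sum_(i < n) 'X_i) ^+ k.
have P0 : nneg P.
  by move=> m; rewrite raddf_sum sumr_ge0 // => k _; apply: mcoeff_sumX_exp_nneg.
have Pm m : (mdeg m <= d)%N -> multinomial_coef R m <= P@_m.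
  rewrite -ltnS => md; rewrite /P raddf_sum (bigD1 (Ordinal md)) //=.
  rewrite -[leLHS]addr0 lerD ?multinomial_coef_le // sumr_ge0 // => k _.
  exact: mcoeff_sumX_exp_nneg.
have PE : \sum_(m <- msupp P) P@_m = \sum_(k < d.+1) n%:R ^+ k.
  transitivity P.@[fun=> 1].
    rewrite mevalE; apply: eq_bigr => m _.
    by rewrite big1 ?mulr1 // => i _; rewrite expr1n.
  rewrite raddf_sum; apply: eq_bigr => k _; rewrite /= rmorphXn /= raddf_sum /=.
  by under eq_bigr do rewrite mevalXU; rewrite sumr_const card_ord.
apply: (@le_trans _ _ (\sum_(m <- msupp P) P@_m)).
  apply: (@le_trans _ _ (\sum_(m <- s) P@_m)).
    by rewrite big_seq [leRHS]big_seq; apply: ler_sum => m /sd; apply: Pm.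
  apply: ler_sum_uniq_sub => // m /sd /Pm h; rewrite mcoeff_msupp.
  by rewrite lt0r_neq0 // (lt_le_trans _ h) // multinomial_coef_gt0.
rewrite PE; apply: (@le_trans _ _ (\sum_(k < d.+1) n%:R ^+ d)).
  by apply: ler_sum => k _; rewrite ler_weXn2l ?ler1n // -ltnS.
by rewrite sumr_const card_ord mulr_natl.
Qed.

Lemma mpoly_norm_ge0 p : 0 <= mpoly_norm p.
Proof.
rewrite /mpoly_norm; elim/big_ind: _ => // [x y x0 _|k _].
  by rewrite le_max x0.
by rewrite divr_ge0 // ltW ?multinomial_coef_gt0.
Qed.

Lemma mcoeff_le_norm p m :
  `|p@_m| <= mpoly_norm p * multinomial_coef R m.
Proof.
rewrite -ler_pdivrMr ?multinomial_coef_gt0 //.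
have [mp|/memN_msupp_eq0->] := boolP (m \in msupp p).
  by rewrite /mpoly_norm; apply: le_bigmax_seq mp _.
by rewrite normr0 mul0r mpoly_norm_ge0.
Qed.

(** The multinomial weights in the norm make the sum of the coefficients cost the
    factor [n ^ d] that appears in the final bound. *)
Lemma l1_bound_norm p d : (0 < n)%N -> msize p = d.+1 ->
  l1_bound d (d.+1%:R * n%:R ^+ d * mpoly_norm p) p.
Proof.
move=> n0 pd; have := l1_bound_msupp p; rewrite pd /=; apply: l1_boundW => //.
rewrite mulrC (le_trans (ler_sum _ (fun m _ => mcoeff_le_norm p m))) //.
rewrite -mulr_sumr ler_wpM2l ?mpoly_norm_ge0 //.
apply: sum_multinomial_coef; rewrite ?msupp_uniq // => m /msize_mdeg_lt.
by rewrite pd.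
Qed.

End NormBound.

(** * Bernstein expansions on the unit cube *)

Section Bernstein.
Variable R : realType.

(** The coefficient of [x ^ k] on the Bernstein polynomial number [j] of degree
    [N], which approximates the value [(j / N) ^ k] at the node. *)
Definition bernstein_coef (N j k : nat) : R := 'C(j, k)%:R / 'C(N, k)%:R.

Lemma bin_mul_trans (N j k : nat) : (k <= j)%N -> (j <= N)%N ->
  ('C(N, j) * 'C(j, k) = 'C(N, k) * 'C(N - k, j - k))%N.
Proof.
move=> kj jN; have kN := leq_trans kj jN.
have f0 : (0 < k`! * ((j - k)`! * (N - j)`!))%N by rewrite !muln_gt0 !fact_gt0.
apply/eqP; rewrite -(eqn_pmul2r f0); apply/eqP.
have e1 := bin_fact jN; have e2 := bin_fact kj; have e3 := bin_fact kN.
have jkNk : (j - k <= N - k)%N by rewrite leq_sub2r.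
have e4 := bin_fact jkNk; rewrite subnBA // subnK // in e4.
transitivity N`!; first by rewrite -e1 -e2; ring.
by rewrite -e3 -e4; ring.
Qed.

(** Multiply [x ^ k] by [1 = ((1 - x) + x) ^ (N - k)] and expand. *)
Lemma bernstein_expn (A : comAlgType R) (x : A) (N k : nat) : (k <= N)%N ->
  x ^+ k = \sum_(j < N.+1) (bernstein_coef N j k * 'C(N, j)%:R) *:
             (x ^+ j * (1 - x) ^+ (N - j)).
Proof.
move=> kN; pose F j := (bernstein_coef N j k * 'C(N, j)%:R) *:
             (x ^+ j * (1 - x) ^+ (N - j)).
have -> : \sum_(j < N.+1) (bernstein_coef N j k * 'C(N, j)%:R) *:
             (x ^+ j * (1 - x) ^+ (N - j)) = \sum_(0 <= j < N.+1) F j.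
  by rewrite big_mkord.
rewrite (@big_cat_nat _ _ _ k) ?leqW //= big_nat big1 ?add0r => [|j jk]; last first.
  by rewrite /F /bernstein_coef bin_small ?mul0r ?scale0r.
(* The terms with [j < k] vanish; the others are indexed by [j - k]. *)
rewrite -[in RHS](add0n k) big_addn subSn // big_mkord.
have -> : x ^+ k = x ^+ k * ((1 - x) + x) ^+ (N - k).
  by rewrite subrK expr1n mulr1.
rewrite exprDn mulr_sumr; apply: eq_bigr => i _; rewrite /F /bernstein_coef.
have iN : (i <= N - k)%N by rewrite -ltnS.
have ikN : (i + k <= N)%N by rewrite addnC -leq_subRL.
have -> : 'C(i + k, k)%:R / 'C(N, k)%:R * 'C(N, (i + k))%:R = 'C(N - k, i)%:R :> R.
  have := bin_mul_trans (leq_addl i k) ikN; rewrite addnK.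
  move=> /(congr1 (fun v => v%:R : R)).
  rewrite !natrM mulrAC [in X in X / _]mulrC => ->.
  by rewrite mulrC mulKf // pnatr_eq0 -lt0n bin_gt0.
rewrite scaler_nat mulrnAr; congr (_ *+ _).
by rewrite [(i + k)%N]addnC subnDA exprD mulrA mulrAC.
Qed.

Lemma bernstein_coef_itv N j k : (j <= N)%N -> 0 <= bernstein_coef N j k <= 1.
Proof.
move=> jN; rewrite divr_ge0 //=.
have [kN|Nk] := leqP k N; last first.
  by rewrite /bernstein_coef !bin_small ?mul0r ?(leq_ltn_trans jN).
by rewrite ler_pdivrMr ?ltr0n ?bin_gt0 // mul1r ler_nat leq_bin2l.
Qed.

Lemma bernstein_coefS N j k : (k < N)%N ->
  bernstein_coef N j k.+1 = bernstein_coef N j k * ((j - k)%:R / (N - k)%:R).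
Proof.
move=> kN; have kS : k.+1%:R != 0 :> R by rewrite pnatr_eq0.
have CN : 'C(N, k)%:R != 0 :> R by rewrite pnatr_eq0 -lt0n bin_gt0 ltnW.
have CN1 : 'C(N, k.+1)%:R != 0 :> R by rewrite pnatr_eq0 -lt0n bin_gt0.
have Nk : (N - k)%:R != 0 :> R by rewrite pnatr_eq0 subn_eq0 -ltnNge.
have e1 : k.+1%:R * 'C(j, k.+1)%:R = (j - k)%:R * 'C(j, k)%:R :> R.
  by rewrite -!natrM mul_bin_left.
have e2 : k.+1%:R * 'C(N, k.+1)%:R = (N - k)%:R * 'C(N, k)%:R :> R.
  by rewrite -!natrM mul_bin_left.
rewrite /bernstein_coef mulf_div [_ * (j - k)%:R]mulrC [_ * (N - k)%:R]mulrC.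
by rewrite -e1 -e2 -mulf_div divff // mul1r.
Qed.

(** The factors [(j - l) / (N - l)], [l < k], of the coefficient are within
    [l / N] of [j / N]. *)
Lemma bernstein_coef_approx N j k : (0 < N)%N -> (j <= N)%N -> (k <= N)%N ->
  `|bernstein_coef N j k - (j%:R / N%:R) ^+ k| <= k%:R ^+ 2 / N%:R.
Proof.
move=> N0 jN; have Nr0 : 0 < N%:R :> R by rewrite ltr0n.
have jN01 : 0 <= (j%:R / N%:R : R) <= 1.
  by rewrite divr_ge0 //= ler_pdivrMr // mul1r ler_nat.
elim: k => [|k IH] kN.
  rewrite /bernstein_coef !bin0 divff ?oner_neq0 // expr0 subrr normr0.
  by rewrite expr0n mul0r.
have {}IH := IH (ltnW kN); rewrite bernstein_coefS // exprSr.
have step : `|(j - k)%:R / (N - k)%:R - j%:R / N%:R| <= k%:R / N%:R :> R.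
  have Nk0 : 0 < (N - k)%:R :> R by rewrite ltr0n subn_gt0.
  have [kj|jk] := leqP k j; last first.
    have -> : (j - k = 0)%N by apply/eqP; rewrite subn_eq0 ltnW.
    rewrite mul0r sub0r normrN ger0_norm ?divr_ge0 //.
    by rewrite ler_pM2r ?invr_gt0 // ler_nat ltnW.
  have e : j%:R / N%:R - (j - k)%:R / (N - k)%:R
      = k%:R / N%:R * ((N - j)%:R / (N - k)%:R) :> R.
    move: (lt0r_neq0 Nk0); rewrite !natrB ?(ltnW kN) // => Nk1; field.
    by rewrite Nk1 (lt0r_neq0 Nr0).
  have r0 (a b : nat) : 0 <= (a%:R / b%:R : R) by rewrite divr_ge0 ?ler0n.
  rewrite distrC e ger0_norm ?(mulr_ge0 (r0 _ _)) //.
  rewrite -[leRHS]mulr1 ler_wpM2l //.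
  by rewrite ler_pdivrMr // mul1r ler_nat leq_sub2l.
have -> : k.+1%:R ^+ 2 / N%:R =
    k%:R ^+ 2 / N%:R + k%:R / N%:R + k.+1%:R / N%:R :> R.
  by rewrite -natr1; ring.
rewrite -[leLHS]addr0 lerD ?divr_ge0 //; apply: lipschitz_mul => //.
- by have /andP[? ?] := bernstein_coef_itv k jN; rewrite ger0_norm.
- by have /andP[? ?] := jN01; rewrite ger0_norm.
Qed.

(** Each Bernstein coefficient of [q] is within [D ^ 2 * A / N] of the value of
    [q] at the corresponding node of the grid, and this value is at least
    [eta]. *)
Lemma bernstein_positive (n N D : nat) (A eta : R) (q : {mpoly R[n]}) :
  l1_bound D A q -> (0 < N)%N -> (D <= N)%N ->
  (forall x : 'I_n -> R, (forall i, 0 <= x i <= 1) -> eta <= q.@[x]) ->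
  D%:R ^+ 2 * A <= eta * N%:R ->
  exists b : {ffun 'I_n -> 'I_N.+1} -> R, (forall phi, 0 <= b phi) /\
    q = \sum_phi b phi *: \prod_i ('X_i ^+ phi i * (1 - 'X_i) ^+ (N - phi i)).
Proof.
move=> [s [-> sD sA]] N0 DN qeta NB.
have Nr0 : 0 < N%:R :> R by rewrite ltr0n.
have sN u (i : 'I_n) : u \in s -> (u.2 i <= D)%N.
  by move=> /sD; apply: leq_trans; rewrite mdegE (bigD1 i) //= leq_addr.
pose c (phi : {ffun 'I_n -> 'I_N.+1}) :=
  \sum_(u <- s) u.1 * \prod_i bernstein_coef N (phi i) (u.2 i).
exists (fun phi => c phi * \prod_i 'C(N, phi i)%:R); split=> [phi|]; last first.
  under [RHS]eq_bigr => phi _ do rewrite /c mulr_suml scaler_suml.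
  rewrite exchange_big /= big_seq [RHS]big_seq; apply: eq_bigr => u us.
  have -> : 'X_[u.2] = \prod_i \sum_(j < N.+1)
      (bernstein_coef N j (u.2 i) * 'C(N, j)%:R) *:
      ('X_i ^+ j * (1 - 'X_i) ^+ (N - j)) :> {mpoly R[n]}.
    rewrite mpolyXE_id; apply: eq_bigr => i _.
    by rewrite -bernstein_expn // (leq_trans (sN _ _ us)).
  rewrite bigA_distr_bigA scaler_sumr; apply: eq_bigr => phi _ /=.
  by rewrite scaler_prod scalerA -mulrA big_split.
rewrite mulr_ge0 ?prodr_ge0 //.
pose x (i : 'I_n) : R := (phi i)%:R / N%:R.
have x01 i : 0 <= x i <= 1.
  by rewrite divr_ge0 //= ler_pdivrMr // mul1r ler_nat -ltnS.
have phiN i : (phi i <= N)%N by rewrite -ltnS.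
have := qeta _ x01; have -> : (\sum_(u <- s) u.1 *: 'X_[u.2]).@[x] =
    \sum_(u <- s) u.1 * \prod_i x i ^+ u.2 i.
  by rewrite raddf_sum /=; apply: eq_bigr => u _; rewrite mevalZ mevalX.
suff : `|c phi - \sum_(u <- s) u.1 * \prod_i x i ^+ u.2 i| <= eta.
  by rewrite ler_norml => /andP[h1 h2] h3; lra.
have : (\sum_(u <- s) `|u.1|) * (D%:R ^+ 2 / N%:R) <= eta.
  rewrite mulrA ler_pdivrMr // (le_trans _ NB) // mulrC.
  by rewrite ler_wpM2l // exprn_ge0.
move=> h; apply: le_trans h; rewrite /c -sumrB mulr_suml.
rewrite (le_trans (ler_norm_sum _ _ _)) // big_seq [leRHS]big_seq.
apply: ler_sum => u us; rewrite -mulrBr normrM ler_wpM2l //.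
have norm01 (v : R) : 0 <= v <= 1 -> `|v| <= 1.
  by move=> /andP[v0 v1]; rewrite ger0_norm.
apply: (@le_trans _ _ (\sum_(i < n) (u.2 i)%:R ^+ 2 / N%:R)).
  apply: lipschitz_prod => i.
  - by apply: norm01; apply: bernstein_coef_itv.
  - by rewrite normrX exprn_ile1 // norm01.
  - by apply: bernstein_coef_approx => //; rewrite (leq_trans (sN _ _ us)).
rewrite -mulr_suml ler_wpM2r ?invr_ge0 ?ler0n //.
apply: (@le_trans _ _ ((mdeg u.2)%:R ^+ 2)); last first.
  by rewrite lerXn2r ?nnegrE ?ler0n // ler_nat sD.
rewrite mdegE natr_sum expr2 mulr_suml; apply: ler_sum => i _.
rewrite expr2 ler_wpM2l ?ler0n // (bigD1 i) //= lerDl.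
by apply: sumr_ge0 => j _; rewrite ler0n.
Qed.

End Bernstein.

(** * Quadratic modules with degree bounds *)

Section SumsOfSquares.
Variables (R : realType) (n : nat).
Implicit Types (p q : {mpoly R[n]}).

Lemma sos0 : is_sos (0 : {mpoly R[n]}).
Proof. by exists [::]; rewrite big_nil. Qed.

Lemma sos_sq p : is_sos (p ^+ 2).
Proof. by exists [:: p]; rewrite big_seq1. Qed.

Lemma sos1 : is_sos (1 : {mpoly R[n]}).
Proof. by have := sos_sq 1; rewrite expr1n. Qed.

Lemma sosD p q : is_sos p -> is_sos q -> is_sos (p + q).
Proof. by move=> [s ->] [t ->]; exists (s ++ t); rewrite big_cat. Qed.

Lemma sos_sum (I : Type) (r : seq I) (P : pred I) (F : I -> {mpoly R[n]}) :
  (forall i, is_sos (F i)) -> is_sos (\sum_(i <- r | P i) F i).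
Proof. by move=> sF; elim/big_ind: _ => //; [exact: sos0 | exact: sosD]. Qed.

Lemma sosM p q : is_sos p -> is_sos q -> is_sos (p * q).
Proof.
move=> [s ->] [t ->]; exists [seq u * v | u <- s, v <- t].
rewrite big_allpairs_dep mulr_suml; apply: eq_bigr => u _.
by rewrite mulr_sumr; apply: eq_bigr => v _; rewrite exprMn.
Qed.

Lemma sosC (c : R) : 0 <= c -> is_sos (c%:MP : {mpoly R[n]}).
Proof.
move=> c0; have := sos_sq (Num.sqrt c)%:MP.
by rewrite -rmorphXn /= sqr_sqrtr.
Qed.

Lemma sosZ (c : R) p : 0 <= c -> is_sos p -> is_sos (c *: p).
Proof. by move=> c0 sp; rewrite -mul_mpolyC; apply: sosM => //; apply: sosC. Qed.

Lemma msizeM_bound p q D E :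
  (msize p <= D.+1)%N -> (msize q <= E.+1)%N -> (msize (p * q) <= (D + E).+1)%N.
Proof.
move=> pD qE.
have [-> |p0] := eqVneq p 0; first by rewrite mul0r msize0.
have [-> |q0] := eqVneq q 0; first by rewrite mulr0 msize0.
rewrite msizeM //.
by move: (mmeasure _ p) (mmeasure _ q) pD qE => a b; lia.
Qed.

Lemma msizeXn_bound p D k : (msize p <= D.+1)%N -> (msize (p ^+ k) <= (k * D).+1)%N.
Proof.
move=> pD; elim: k => [|k IH]; first by rewrite expr0 msize1.
by rewrite exprS mulSn; apply: msizeM_bound.
Qed.

Lemma msize_prod_bound (F : 'I_n -> {mpoly R[n]}) (D : 'I_n -> nat) :
  (forall i, (msize (F i) <= (D i).+1)%N) ->
  (msize (\prod_i F i) <= (\sum_i D i).+1)%N.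
Proof.
move=> FD; elim/big_ind2: _ => //; first by rewrite msize1.
by move=> p k q l; apply: msizeM_bound.
Qed.

End SumsOfSquares.

Section TruncatedModule.
Variables (R : realType) (n m : nat) (g : m.-tuple {mpoly R[n]}).
Implicit Types (p q : {mpoly R[n]}).

(** A bound on [msize], which is [0] for the zero polynomial, spares the case
    distinction of the truncated quadratic module in all closure properties. *)
Definition qmodule_deg (K : nat) p :=
  exists sigma : 'I_m.+1 -> {mpoly R[n]},
    [/\ forall i, is_sos (sigma i),
        forall i, (msize (sigma i * tnth (gens g) i) <= K.+1)%N
      & p = \sum_(i < m.+1) sigma i * tnth (gens g) i].

Lemma qmodule_deg_truncated K p (k : R) :
  K%:R <= k -> qmodule_deg K p -> truncated_quadratic_module g k p.
Proof.
move=> Kk [sigma [s1 s2 s3]]; exists sigma; split=> // i; right.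
by apply: le_trans Kk; rewrite ler_nat; have := s2 i; lia.
Qed.

Lemma qmodule_degW K L p : (K <= L)%N -> qmodule_deg K p -> qmodule_deg L p.
Proof.
move=> KL [sigma [s1 s2 s3]]; exists sigma; split=> // i.
exact: leq_trans (s2 i) _.
Qed.

Lemma qmodule_deg_ex p : quadratic_module g p -> exists K, qmodule_deg K p.
Proof.
move=> [sigma [s1 s2]].
exists (\max_(i < m.+1) msize (sigma i * tnth (gens g) i))%N.
exists sigma; split=> // i; apply: leqW.
exact: (@leq_bigmax _ (fun i => msize (sigma i * tnth (gens g) i))).
Qed.

Lemma qmodule_deg0 K : qmodule_deg K 0.
Proof.
exists (fun=> 0); split=> [i|i|]; first exact: sos0.
  by rewrite mul0r msize0.
by rewrite big1 // => i _; rewrite mul0r.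
Qed.

Lemma qmodule_degD K p q :
  qmodule_deg K p -> qmodule_deg K q -> qmodule_deg K (p + q).
Proof.
move=> [s [s1 s2 ->]] [t [t1 t2 ->]]; exists (fun i => s i + t i); split.
- by move=> i; apply: sosD.
- move=> i; rewrite mulrDl (leq_trans (msizeD_le _ _)) // geq_max.
  by rewrite s2 t2.
- by rewrite -big_split; apply: eq_bigr => i _; rewrite mulrDl.
Qed.

Lemma qmodule_deg_sum K (I : Type) (r : seq I) (F : I -> {mpoly R[n]}) :
  (forall i, qmodule_deg K (F i)) -> qmodule_deg K (\sum_(i <- r) F i).
Proof.
by move=> h; elim/big_ind: _ => //; [exact: qmodule_deg0|exact: qmodule_degD].
Qed.

Lemma qmodule_deg_sq K L p q : (msize q <= L.+1)%N ->
  qmodule_deg K p -> qmodule_deg (L + L + K) (q ^+ 2 * p).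
Proof.
move=> qL [s [s1 s2 ->]]; exists (fun i => q ^+ 2 * s i); split.
- by move=> i; apply: sosM => //; apply: sos_sq.
- by move=> i; rewrite -mulrA; apply: msizeM_bound => //; apply: msizeM_bound.
- by rewrite mulr_sumr; apply: eq_bigr => i _; rewrite mulrA.
Qed.

Lemma qmodule_degZ K (c : R) p :
  0 <= c -> qmodule_deg K p -> qmodule_deg K (c *: p).
Proof.
move=> c0 /(@qmodule_deg_sq _ 0 _ (Num.sqrt c)%:MP); rewrite !add0n.
rewrite -rmorphXn /= sqr_sqrtr // mul_mpolyC; apply.
by rewrite msizeC; case: eqP.
Qed.

Lemma qmodule_deg_gen K (i : 'I_m) p : is_sos p ->
  (msize (p * tnth g i) <= K.+1)%N -> qmodule_deg K (p * tnth g i).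
Proof.
move=> sp pK; pose j := lift ord0 i.
have gE : tnth (gens g) j = tnth g i by rewrite tnthS.
exists (fun l => if l == j then p else 0); split=> [l|l|].
- by case: eqP => // _; apply: sos0.
- by case: eqP => [->|_]; rewrite ?gE // mul0r msize0.
- rewrite (bigD1 j) //= eqxx gE big1 ?addr0 // => l /negPf->.
  by rewrite mul0r.
Qed.

Lemma qmodule_deg_sos K p :
  is_sos p -> (msize p <= K.+1)%N -> qmodule_deg K p.
Proof.
move=> sp pK; exists (fun i => if i == ord0 then p else 0); split=> [i|i|].
- by case: eqP => // _; apply: sos0.
- case: eqP => [->|_]; last by rewrite mul0r msize0.
  by rewrite /gens tnth0 mulr1.
- rewrite big_ord_recl /= big1 ?addr0 => [|i _]; last by rewrite mul0r.
  by rewrite /gens tnth0 mulr1.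
Qed.

Lemma quadratic_module_sos p : is_sos p -> quadratic_module g p.
Proof.
by move=> sp; have [s [s1 _ s2]] := qmodule_deg_sos sp (leqnSn _); exists s.
Qed.

Lemma quadratic_moduleD p q :
  quadratic_module g p -> quadratic_module g q -> quadratic_module g (p + q).
Proof.
move=> [s [s1 ->]] [t [t1 ->]]; exists (fun i => s i + t i); split.
  by move=> i; apply: sosD.
by rewrite -big_split; apply: eq_bigr => i _; rewrite mulrDl.
Qed.

Lemma quadratic_moduleM p q :
  is_sos p -> quadratic_module g q -> quadratic_module g (p * q).
Proof.
move=> sp [s [s1 ->]]; exists (fun i => p * s i); split.
  by move=> i; apply: sosM.
by rewrite mulr_sumr; apply: eq_bigr => i _; rewrite mulrA.
Qed.

End TruncatedModule.

(** * The box defined by the archimedean property *)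

Section BoxProducts.
Variables (R : realType) (n m : nat) (g : m.-tuple {mpoly R[n]}).
Implicit Types (p q : {mpoly R[n]}).

(** A quadratic module with a single generator [p] is closed under products,
    because [p ^ 2] is a square. *)
Definition preorder1 p q := exists s t, [/\ is_sos s, is_sos t & q = s + t * p].

Lemma preorder1_sos p q : is_sos q -> preorder1 p q.
Proof.
by move=> sq; exists q, 0; split; rewrite ?mul0r ?addr0 //; apply: sos0.
Qed.

Lemma preorder1_gen p : preorder1 p p.
Proof.
by exists 0, 1; split; rewrite ?mul1r ?add0r //; [apply: sos0 | apply: sos1].
Qed.

Lemma preorder1D p q r : preorder1 p q -> preorder1 p r -> preorder1 p (q + r).
Proof.
move=> [s [t [s1 t1 ->]]] [s' [t' [s1' t1' ->]]].
by exists (s + s'), (t + t'); split; [exact: sosD|exact: sosD|ring].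
Qed.

Lemma preorder1M p q r : preorder1 p q -> preorder1 p r -> preorder1 p (q * r).
Proof.
move=> [s [t [s1 t1 ->]]] [s' [t' [s1' t1' ->]]].
exists (s * s' + t * t' * p ^+ 2), (s * t' + t * s'); split; last by ring.
  apply: sosD; first exact: sosM.
  by apply: sosM; [exact: sosM | exact: sos_sq].
by apply: sosD; exact: sosM.
Qed.

Lemma preorder1Z p q (c : R) : 0 <= c -> preorder1 p q -> preorder1 p (c *: q).
Proof.
move=> c0 pq; rewrite -mul_mpolyC; apply: preorder1M => //.
by apply: preorder1_sos; apply: sosC.
Qed.

Lemma preorder1Xn p q k : preorder1 p q -> preorder1 p (q ^+ k).
Proof.
move=> pq; elim: k => [|k IH]; last by rewrite exprS; apply: preorder1M.
by apply: preorder1_sos; apply: sos1.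
Qed.

Lemma preorder1_prod p (F : 'I_n -> {mpoly R[n]}) :
  (forall i, preorder1 p (F i)) -> preorder1 p (\prod_i F i).
Proof.
move=> h; elim/big_ind: _ => //; last by move=> *; apply: preorder1M.
by apply: preorder1_sos; apply: sos1.
Qed.

(** If [a ^ 2 - x ^ 2 >= 0] is certified then so is [a - x >= 0], since
    [2 a (a - x) = (a - x) ^ 2 + (a ^ 2 - x ^ 2)]. *)
Lemma preorder1_linear p q (a : R) : 0 < a ->
  preorder1 p ((a ^+ 2)%:MP - q ^+ 2) -> preorder1 p (a%:MP - q).
Proof.
move=> a0 pq; have a2 : 0 < 2 * a by rewrite mulr_gt0.
have -> : a%:MP - q = (2 * a)^-1 *:
    ((a%:MP - q) ^+ 2 + ((a ^+ 2)%:MP - q ^+ 2)).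
  apply: (canRL (scalerK (lt0r_neq0 a2))); rewrite -mul_mpolyC.
  by rewrite [(a ^+ 2)%:MP]rmorphXn /= mpolyCM mpolyC_nat; ring.
apply: preorder1Z; first by rewrite invr_ge0 ltW.
by apply: preorder1D => //; apply: preorder1_sos; apply: sos_sq.
Qed.

(** The ball polynomial alone certifies the faces of a large box, hence all
    products of them; the single generator makes these products available
    although a quadratic module need not be closed under products. *)
Lemma archimedean_box_products : archimedean g ->
  exists2 a : R, 1 <= a & forall d e : 'I_n -> nat,
    quadratic_module g
      (\prod_i ((a%:MP + 'X_i) ^+ d i * (a%:MP - 'X_i) ^+ e i)).
Proof.
move=> [N gN]; set p := _ - _ in gN; pose a : R := N.+1%:R.
have a1 : 1 <= a by rewrite ler1n.
have a0 : 0 < a by rewrite (lt_le_trans _ a1).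
exists a => // d e.
have sq i : preorder1 p ((a ^+ 2)%:MP - 'X_i ^+ 2).
  have -> : (a ^+ 2)%:MP - 'X_i ^+ 2 =
      p + ((a ^+ 2 - N%:R)%:MP + \sum_(j | j != i) 'X_j ^+ 2).
    by rewrite /p (bigD1 i) //= mpolyCB mpolyC_nat; ring.
  apply: preorder1D; first exact: preorder1_gen.
  apply: preorder1_sos; apply: sosD; last by apply: sos_sum => j; apply: sos_sq.
  by apply: sosC; rewrite subr_ge0 -natrX ler_nat; lia.
have [s [t [ss st ->]]] : preorder1 p
    (\prod_i ((a%:MP + 'X_i) ^+ d i * (a%:MP - 'X_i) ^+ e i)).
  apply: preorder1_prod => i; apply: preorder1M; apply: preorder1Xn.
    rewrite -['X_i]opprK; apply: preorder1_linear => //.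
    by rewrite sqrrN.
  exact: preorder1_linear.
apply: quadratic_moduleD; first exact: quadratic_module_sos.
exact: quadratic_moduleM.
Qed.

End BoxProducts.

(** * From positivity on a box to membership *)

Section Engine.
Variable R : realType.

(** Bernoulli: [(1 - y) ^ K * (1 + K y) <= 1]. *)
Lemma bump_le (y : R) (K : nat) : 0 <= y <= 1 -> K%:R * ((1 - y) ^+ K * y) <= 1.
Proof.
move=> /andP[y0 y1]; suff : (1 - y) ^+ K * (1 + K%:R * y) <= 1.
  have : 0 <= (1 - y) ^+ K by rewrite exprn_ge0 // subr_ge0.
  by move=> *; lra.
elim: K => [|K IH]; first by rewrite expr0 mul0r addr0 mul1r.
apply: le_trans IH; rewrite exprSr -mulrA ler_wpM2l ?exprn_ge0 ?subr_ge0 //.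
rewrite -natr1; have : 0 <= (K%:R + 1) * y ^+ 2.
  by rewrite mulr_ge0 ?exprn_ge0 // addr_ge0 ?ler0n.
move=> h; rewrite -subr_ge0.
have -> : 1 + K%:R * y - (1 - y) * (1 + (K%:R + 1) * y) = (K%:R + 1) * y ^+ 2.
  by ring.
exact: h.
Qed.

(** Where [y >= 0], subtracting [lambda (1 - y) ^ (2 k) y] costs at most
    [lambda / (2 k)], so [eps / 2] for all terms together; where one [y] is at
    most [- delta] it gains [lambda delta], which outweighs a negative [phi]. *)
Lemma perturbation (m k : nat) (y : 'I_m -> R) (phi A eps delta lambda : R) :
  (forall i, `|y i| <= 1) -> (0 < k)%N -> 0 <= lambda ->
  `|phi| <= A -> eps <= phi \/ (exists i, y i <= - delta) -> 0 <= delta ->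
  0 <= eps -> A + eps <= lambda * delta -> lambda * m%:R <= eps * k%:R ->
  eps / 2 <= phi - lambda * \sum_i (1 - y i) ^+ (2 * k) * y i.
Proof.
move=> y1 k0 l0 phiA alt d0 e0 Al lk; have kr : 0 < k%:R :> R by rewrite ltr0n.
pose F i := (1 - y i) ^+ (2 * k) * y i.
have e1 (z : R) : 0 <= (1 - z) ^+ (2 * k) by rewrite exprM exprn_ge0 ?sqr_ge0.
have Fle i : F i <= (2 * k%:R)^-1.
  have [yi|yi] := lerP 0 (y i).
    rewrite -[leRHS]mul1r ler_pdivlMr ?mulr_gt0 // mulrC -natrM.
    by apply: bump_le; rewrite yi /=; have := y1 i; rewrite ger0_norm.
  apply: (@le_trans _ _ 0); last by rewrite invr_ge0 mulr_ge0 ?ler0n.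
  by rewrite nmulr_lle0.
have lm : lambda * (m%:R / (2 * k%:R)) <= eps / 2.
  have -> : lambda * (m%:R / (2 * k%:R)) = lambda * m%:R / k%:R / 2.
    by field; rewrite lt0r_neq0.
  by rewrite ler_pM2r ?invr_gt0 // ler_pdivrMr.
have sumc (P : pred 'I_m) : \sum_(i | P i) F i <= m%:R / (2 * k%:R).
  apply: (@le_trans _ _ (\sum_(i | P i) (2 * k%:R)^-1)).
    by apply: ler_sum => i _.
  rewrite sumr_const -[_ *+ _]mulr_natl ler_wpM2r ?invr_ge0 ?mulr_ge0 ?ler0n //.
  by rewrite ler_nat -[leqRHS]card_ord max_card.
have /andP[A1 A2] : - A <= phi <= A by rewrite -ler_norml.
have {}sumc P : lambda * \sum_(i | P i) F i <= eps / 2.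
  by apply: le_trans lm; rewrite ler_wpM2l.
case: alt => [phie|[i yi]].
  by have := sumc xpredT; rewrite -/F; lra.
rewrite (bigD1 i) //= mulrDr -/(F i).
have Fi : lambda * F i <= lambda * - delta.
  rewrite ler_wpM2l // /F -[- delta]mul1r.
  have h1 : 1 <= (1 - y i) ^+ (2 * k) by rewrite exprn_ege1 //; lra.
  have h2 : (1 - y i) ^+ (2 * k) * y i <= 1 * y i by rewrite ler_wnM2r //; lra.
  lra.
by have := sumc (fun j => j != i); lra.
Qed.

End Engine.

Section BoxCertificate.
Variables (R : realType) (n : nat).
Implicit Types (f h p : {mpoly R[n]}).

Definition face_product (a : R) (d e : 'I_n -> nat) : {mpoly R[n]} :=
  \prod_i ((a%:MP + 'X_i) ^+ d i * (a%:MP - 'X_i) ^+ e i).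

(** The substitution [x = a (2 y - 1)] turns the box into the unit cube and
    multiplies the coefficients of terms of degree [D] by at most
    [(3 a) ^ D]. *)
Lemma box_certificate (a A eta : R) (D N : nat) h :
  1 <= a -> l1_bound D A h -> (0 < N)%N -> (D <= N)%N ->
  (forall x : 'I_n -> R, (forall i, `|x i| <= a) -> eta <= h.@[x]) ->
  D%:R ^+ 2 * (A * (3 * a) ^+ D) <= eta * N%:R ->
  exists b : {ffun 'I_n -> 'I_N.+1} -> R, (forall phi, 0 <= b phi) /\
    h = \sum_phi b phi *:
          face_product a (fun i => phi i) (fun i => (N - phi i)%N).
Proof.
move=> a1 hA N0 DN heta NB.
have a0 : 0 < a by rewrite (lt_le_trans _ a1).
have a2 : 2 * a != 0 by rewrite mulf_neq0 ?lt0r_neq0.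
pose lq := [tuple a *: (2 *: 'X_i - 1) : {mpoly R[n]} | i < n].
pose lr := [tuple (2 * a)^-1 *: (a%:MP + 'X_i) : {mpoly R[n]} | i < n].
have bq : l1_bound D (A * (3 * a) ^+ D) (h \mPo lq).
  apply: l1_bound_comp => // [|i]; first by lra.
  rewrite tnth_mktuple mulrC -[X in l1_bound _ (X * _)](gtr0_norm a0).
  apply: l1_boundZ.
  have -> : 3 = `|2 : R| * 1 + `|-1 : R| by rewrite normrN1 ger0_norm; lra.
  apply: l1_boundD; first by apply: l1_boundZ; apply: l1_boundX.
  have := l1_boundC n (-1 : R); rewrite rmorphN1.
  exact: l1_boundW.
have [|b [b0 qE]] := bernstein_positive bq N0 DN _ NB.
  move=> x x01; rewrite comp_mpoly_meval; apply: heta => i.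
  rewrite tnth_mktuple mevalZ mevalB mevalZ mevalXU meval1 normrM gtr0_norm //.
  by rewrite ler_piMr ?(ltW a0) // ler_norml; have := x01 i; lra.
have hE : (h \mPo lq) \mPo lr = h.
  have csum (t : n.-tuple {mpoly R[n]}) (r : seq 'X_{1..n}) F :
      (\sum_(u <- r) F u) \mPo t = \sum_(u <- r) (F u \mPo t).
    exact: (raddf_sum (comp_mpoly t)).
  rewrite [h]mpolyE (csum lq) (csum lr); apply: eq_bigr => u _.
  rewrite !comp_mpolyZ comp_mpolyX rmorph_prod mpolyXE_id /=; congr (_ *: _).
  apply: eq_bigr => i _; rewrite rmorphXn /= tnth_mktuple comp_mpolyZ.
  rewrite comp_mpolyB comp_mpolyZ comp_mpolyXU comp_mpoly1.
  rewrite -tnth_nth tnth_mktuple scalerBr !scalerA scalerDr.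
  have -> : a * 2 * (2 * a)^-1 = 1 by rewrite [a * 2]mulrC divff.
  rewrite !scale1r -[a *: 1]mul_mpolyC mulr1.
  by congr (_ ^+ _); ring.
exists (fun phi => b phi * \prod_(i < n) (2 * a)^-1 ^+ N); split=> [phi|].
  by rewrite mulr_ge0 // prodr_ge0 // => i _; rewrite exprn_ge0 // invr_ge0; lra.
rewrite -hE qE raddf_sum /=; apply: eq_bigr => phi _.
rewrite comp_mpolyZ -scalerA; congr (_ *: _).
rewrite rmorph_prod /= /face_product -scaler_prod; apply: eq_bigr => i _.
rewrite rmorphM !rmorphXn rmorphB /= comp_mpoly1 comp_mpolyXU -tnth_nth.
rewrite tnth_mktuple; set u := (2 * a)^-1.
have -> : 1 - u *: (a%:MP + 'X_i) = u *: (a%:MP - 'X_i) :> {mpoly R[n]}.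
  apply/eqP; rewrite subr_eq -scalerDr addrACA addNr addr0 -mpolyCD.
  rewrite -mul_mpolyC -mpolyCM /u mulrC -mulr2n -[a *+ 2]mulr_natl.
  by rewrite divff // mpolyC1.
rewrite !exprZn -scalerAl -scalerAr scalerA -exprD subnKC //.
by rewrite -ltnS.
Qed.

Variables (m : nat) (g : m.-tuple {mpoly R[n]}).

(** Even powers are squares, so only the finitely many squarefree products of
    faces have to be certified. *)
Lemma faces_qmodule (a : R) (K0 N : nat) (phi : {ffun 'I_n -> 'I_N.+1}) :
  (forall d e : {ffun 'I_n -> bool}, qmodule_deg g K0
     (face_product a (fun i => d i : nat) (fun i => e i : nat))) ->
  qmodule_deg g (n * N + K0) (face_product a (fun i => phi i) (fun i => (N - phi i)%N)).
Proof.
move=> K0P; pose d := [ffun i => odd (phi i)].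
pose e := [ffun i => odd (N - phi i)].
pose q := face_product a (fun i => (phi i)./2) (fun i => (N - phi i)./2).
have -> : face_product a (fun i => phi i) (fun i => (N - phi i)%N) =
    q ^+ 2 * face_product a (fun i => d i : nat) (fun i => e i : nat).
  rewrite /q /face_product expr2 -!big_split; apply: eq_bigr => i _ /=.
  rewrite !ffunE -{1}[phi i : nat]odd_double_half.
  rewrite -{1}[(N - phi i)%N]odd_double_half !exprD -!addnn !exprD.
  by ring.
pose L := (\sum_(i < n) ((phi i)./2 + (N - phi i)./2))%N.
have qL : (msize q <= L.+1)%N.
  apply: msize_prod_bound => i; apply: msizeM_bound.
    rewrite -[X in (_ <= X.+1)%N]muln1; apply: msizeXn_bound.
    rewrite (leq_trans (msizeD_le _ _)) // geq_max msizeC msizeX mdeg1.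
    by case: eqP.
  rewrite -[X in (_ <= X.+1)%N]muln1; apply: msizeXn_bound.
  rewrite (leq_trans (msizeD_le _ _)) // geq_max msizeN msizeC msizeX mdeg1.
  by case: eqP.
apply: qmodule_degW (qmodule_deg_sq qL (K0P d e)).
rewrite leq_add2r /L -big_split /=.
apply: (@leq_trans (\sum_(i < n) N)%N); last by rewrite sum_nat_const card_ord.
apply: leq_sum => i _; rewrite addnACA !addnn.
have phiN : (phi i <= N)%N by rewrite -ltnS.
rewrite -[leqRHS](subnKC phiN) leq_add //.
  by rewrite -[leqRHS]odd_double_half leq_addl.
by rewrite -[leqRHS]odd_double_half leq_addl.
Qed.

(** With [u_i = g_i / gamma], the difference
    [h = f - lambda sum_i (1 - u_i) ^ (2 k) u_i] is at least [eps / 2] on the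
    whole box, so it has a Bernstein expansion, and the terms that were subtracted
    are squares times [g_i]. The hypotheses on [lambda], [k] and [N] are kept as
    explicit inequalities: any large values give the qualitative theorem, and
    estimating them gives the degree bound. *)
Lemma putinar_bounded (a gamma A eps delta lambda G : R)
    (K0 D e k N : nat) f :
  1 <= a -> 0 < gamma ->
  (forall d e : {ffun 'I_n -> bool}, qmodule_deg g K0
     (face_product a (fun i => d i : nat) (fun i => e i : nat))) ->
  (forall i, l1_bound e G (gamma^-1 *: tnth g i)) ->
  (forall i, (msize (tnth g i) <= e.+1)%N) ->
  (forall (x : 'I_n -> R) i, (forall j, `|x j| <= a) ->
     `|(gamma^-1 *: tnth g i).@[x]| <= 1) ->
  l1_bound D A f ->
  ((2 * k).+1 * e <= D)%N ->
  (forall x : 'I_n -> R, (forall i, `|x i| <= a) -> `|f.@[x]| <= A) ->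
  (forall x : 'I_n -> R, (forall i, `|x i| <= a) ->
     eps <= f.@[x] \/ exists i, (gamma^-1 *: tnth g i).@[x] <= - delta) ->
  0 <= delta -> 0 <= eps -> (0 < k)%N -> 0 <= lambda ->
  A + eps <= lambda * delta -> lambda * m%:R <= eps * k%:R ->
  (0 < N)%N -> (D <= N)%N ->
  D%:R ^+ 2 * ((A + lambda * (m%:R * ((1 + G) ^+ (2 * k) * G))) * (3 * a) ^+ D)
    <= eps / 2 * N%:R ->
  qmodule_deg g (n * N + K0 + D) f.
Proof.
move=> a1 gamma0 K0P uG ge u1 fA kD fA' alt d0 e0 k0 l0 Al lk N0 DN NB.
pose u i := gamma^-1 *: tnth g i.
pose s i := (1 - u i) ^+ (2 * k) * u i.
pose h := f - lambda *: \sum_i s i.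
have -> : f = h + \sum_i (lambda / gamma) *: ((1 - u i) ^+ (2 * k)) * tnth g i.
  rewrite /h -[LHS]addr0 -addrA; congr (_ + _); apply/esym/eqP.
  rewrite addrC subr_eq0 scaler_sumr; apply/eqP/eq_bigr => i _.
  by rewrite /s /u -scalerAl -scalerAr scalerA.
have hA : l1_bound D (A + lambda * (m%:R * ((1 + G) ^+ (2 * k) * G))) h.
  apply: l1_boundD => //; rewrite -scaleNr.
  have lE : `|- lambda| = lambda by rewrite normrN ger0_norm.
  rewrite -{1}lE; apply: l1_boundZ.
  have -> : m%:R * ((1 + G) ^+ (2 * k) * G) =
      \sum_(i < m) (1 + G) ^+ (2 * k) * G.
    by rewrite sumr_const card_ord mulr_natl.
  apply: l1_bound_sum => i; apply: (@l1_boundW _ _ ((2 * k) * e + e)) => //.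
    by rewrite addnC -mulSn.
  apply: l1_boundM; last exact: uG.
  apply: (@l1_boundXn R n e (1 + G) (1 - u i) (2 * k)).
  apply: l1_boundD.
    by have := l1_boundC n (1 : R); rewrite mpolyC1 normr1; apply: l1_boundW.
  rewrite -scaleN1r; have := l1_boundZ (-1) (uG i).
  by rewrite normrN1 mul1r.
have heps x : (forall i, `|x i| <= a) -> eps / 2 <= h.@[x].
  move=> xa; rewrite /h mevalB mevalZ raddf_sum /=.
  have -> : \sum_i (s i).@[x] =
      \sum_i (1 - (u i).@[x]) ^+ (2 * k) * (u i).@[x].
    by apply: eq_bigr => i _; rewrite mevalM rmorphXn /= mevalB meval1.
  apply: (@perturbation _ _ _ (fun i => (u i).@[x]) _ A _ delta) => //.
  - by move=> i; apply: u1.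
  - exact: fA'.
  - exact: alt.
apply: qmodule_degD.
  have [b [b0 ->]] := box_certificate a1 hA N0 DN heps NB.
  apply: qmodule_deg_sum => phi; apply: qmodule_degZ => //.
  by apply: qmodule_degW (faces_qmodule phi K0P); rewrite leq_addr.
apply: qmodule_deg_sum => i; apply: qmodule_deg_gen.
  apply: sosZ; first by rewrite divr_ge0 // ltW.
  by rewrite mulnC exprM; apply: sos_sq.
have -> : (lambda / gamma) *: (1 - u i) ^+ (2 * k) * tnth g i =
   lambda *: ((1 - u i) ^+ (2 * k) * u i).
  by rewrite -scalerAl -scalerAr scalerA.
rewrite (leq_trans (msizeZ_le _ _)) //.
apply: (@leq_trans ((2 * k) * e + e).+1); last first.
  by rewrite ltnS addnC -mulSn (leq_trans kD) // leq_addl.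
apply: msizeM_bound; last by rewrite (leq_trans (msizeZ_le _ _)).
apply: msizeXn_bound; rewrite (leq_trans (msizeD_le _ _)) // geq_max msize1 /=.
by rewrite msizeN (leq_trans (msizeZ_le _ _)).
Qed.

End BoxCertificate.

(** * Compactness of boxes *)

Module Compactness.
From mathcomp Require Import boolp filter topology normedtype.
Import numFieldNormedType.Exports.

(** The Heine-Borel theorem, phrased without open covers: [Q x d] will be a
    disjunction of lower bounds by [d] on polynomials, and such a disjunction
    spreads from a point to a neighbourhood at the price of a smaller [d]. *)
Lemma box_uniform (R : realType) (n : nat) (a : R)
    (Q : ('I_n -> R) -> R -> Prop) :
  (forall x (d d' : R), 0 < d' <= d -> Q x d -> Q x d') ->
  (forall x, (forall i, `|x i| <= a) -> exists2 d : R, 0 < d &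
     forall y, (forall i, `|y i| <= a) -> (forall i, `|x i - y i| < d) ->
     Q y d) ->
  exists2 d : R, 0 < d & forall x, (forall i, `|x i| <= a) -> Q x d.
Proof.
move=> Qmono Qloc.
pose K := [set v : 'rV[R]_n | forall i, `[- a, a]%classic (v ord0 i)].
have cK : compact K.
  apply: (@rV_compact R n (fun=> `[- a, a]%classic)) => i.
  exact: segment_compact.
have KP (v : 'rV[R]_n) : (forall i, `|v ord0 i| <= a) <-> K v.
  by split=> h i; have := h i; rewrite /= in_itv /= ler_norml.
have /compact_near_coveringP cov := cK.
have near_Q : \forall d \near 0^'+, K `<=` [set v | K v -> Q (v ord0) d].
  apply: (cov R 0^'+ (fun d v => K v -> Q (v ord0) d)) => v /KP vK.
  have [d d0 dQ] := Qloc _ vK.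
  exists ([set w : 'rV[R]_n | forall i, `|v ord0 i - w ord0 i| < d],
          [set e : R | 0 < e <= d]).
    split=> /=.
      apply/nbhs_ballP; exists d => //= w [vw].
      by move=> vw' i; apply: vw'.
    near=> e; apply/andP; split; near: e; first exact: nbhs_right_gt.
    exact: nbhs_right_le.
  move=> [w e] [/= wd ed] /KP wK; apply: (Qmono _ d) => //.
  by apply: dQ => // i; apply: wd.
have [e [e0 eQ]] : exists e : R, 0 < e /\ K `<=` [set v | K v -> Q (v ord0) e].
  near (0 : R)^'+ => e; exists e; split; near: e => //.
  exact: nbhs_right_gt.
exists e => // x xa; pose v := \row_i x i.
have vx : v ord0 = x by apply/funext => i; rewrite mxE.
have Kv : K v by apply/KP => i; rewrite mxE.
by have := eQ _ Kv Kv; rewrite /= vx.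
Unshelve. all: by end_near. Qed.

End Compactness.

(** * Semialgebraic subsets of the plane near an axis *)

Module SmallParameter.
Import ordered_qelim.ord.

Lemma poly_lowest_term (A : idomainType) (p : {poly A}) :
  p != 0 -> exists (e : nat) (a : A) (q : {poly A}),
    a != 0 /\ p = ('X * q + a%:P) * 'X^e.
Proof.
elim/poly_ind: p => [|p c IH]; first by rewrite eqxx.
have [-> |c0 _] := eqVneq c 0; last first.
  by exists 0%N, c, p; rewrite expr0 mulr1 mulrC.
rewrite addr0 => pX0.
have p0 : p != 0 by apply: contraNneq pX0 => ->; rewrite mul0r.
have [e [a [q [a0 ->]]]] := IH p0.
by exists e.+1, a, q; rewrite exprSr mulrA.
Qed.

Lemma poly_bounded_unit (R : realFieldType) (p : {poly R}) :
  exists2 K : R, 0 < K & forall t : R, 0 <= t <= 1 -> `|p.[t]| <= K.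
Proof.
elim/poly_ind: p => [|p c [K K0 IH]].
  by exists 1 => // t _; rewrite horner0 normr0.
exists (K + `|c| + 1) => [|t t01]; first by have := normr_ge0 c; lra.
rewrite hornerMXaddC (le_trans (ler_normD _ _)) // normrM.
have := IH _ t01; have : `|t| <= 1 by rewrite ger0_norm; lra.
move=> t1 pK; have : `|p.[t]| * `|t| <= K * 1 by rewrite ler_pM.
lra.
Qed.

Lemma poly2_bounded_unit (R : realFieldType) (p : {poly {poly R}}) :
  exists2 K : R, 0 < K &
    forall t s : R, 0 <= t <= 1 -> 0 <= s <= 1 -> `|p.[s%:P].[t]| <= K.
Proof.
elim/poly_ind: p => [|p c [K K0 IH]].
  by exists 1 => // t s _ _; rewrite !horner0 normr0.
have [K' K'0 cK'] := poly_bounded_unit c.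
exists (K + K') => [|t s t01 s01]; first by rewrite addr_gt0.
rewrite hornerMXaddC hornerD hornerM hornerC.
rewrite (le_trans (ler_normD _ _)) // lerD ?cK' // normrM.
have := IH _ _ t01 s01; have : `|s| <= 1 by rewrite ger0_norm; lra.
by move=> s1 pK; rewrite -[K]mulr1 ler_pM.
Qed.

(** Near [0] a nonzero polynomial behaves like its lowest order term. *)
Lemma poly_lower_bound (R : realFieldType) (p : {poly R}) : p != 0 ->
  exists (c : R) (r : nat), 0 < c <= 1 /\
    forall t : R, 0 < t <= c -> c * t ^+ r <= `|p.[t]|.
Proof.
move=> /poly_lowest_term[r [a [q [a0 ->]]]].
have [K K0 qK] := poly_bounded_unit q.
have na : 0 < `|a| by rewrite normr_gt0.
pose c := Num.min 1 (Num.min (`|a| / 2) (`|a| / (2 * K))).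
have c0 : 0 < c by rewrite !lt_min ltr01 !divr_gt0 // mulr_gt0.
have c1 : c <= 1 by rewrite ge_min lexx.
have c2 : c <= `|a| / 2 by rewrite !ge_min lexx !orbT.
have c3 : c * K <= `|a| / 2.
  have : c <= `|a| / (2 * K) by rewrite !ge_min lexx !orbT.
  by rewrite ler_pdivlMr ?mulr_gt0 // => h; lra.
exists c, r; split=> [|t /andP[t0 tc]]; first by rewrite c0.
rewrite hornerM hornerXn hornerD hornerM hornerX hornerC normrM.
have tr : 0 <= t ^+ r by rewrite exprn_ge0 ?ltW.
rewrite [`|t ^+ r|]ger0_norm // ler_wpM2r //.
have tq : `|t * q.[t]| <= `|a| / 2.
  rewrite normrM gtr0_norm // (le_trans _ c3) //.
  have t01 : 0 <= t <= 1 by lra.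
  by apply: ler_pM => //; [exact: ltW | exact: qK].
have := ler_normB (t * q.[t] + a) (t * q.[t]).
by rewrite addrAC subrr add0r; lra.
Qed.

(** The order in which [t] and [s] are small matters: once [s] is below a fixed
    power of [t], the lowest term in [s] dominates, and its coefficient is a
    nonzero polynomial in [t]. *)
Lemma poly2_sign_stable (R : realFieldType) (p : {poly {poly R}}) :
  exists (c : R) (r : nat), 0 < c <= 1 /\
    forall t s s' : R, 0 < t <= c -> 0 < s < c * t ^+ r -> 0 < s' < c * t ^+ r ->
    Num.sg p.[s%:P].[t] = Num.sg p.[s'%:P].[t].
Proof.
have [-> |p0] := eqVneq p 0.
  by exists 1, 0%N; split; rewrite ?ltr01 ?lexx // => *; rewrite !horner0.
have [e [a [q [a0 ->]]]] := poly_lowest_term p0.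
have [K K0 qK] := poly2_bounded_unit q.
have [c [r [c01 ac]]] := poly_lower_bound a0.
pose d := Num.min c (c / K).
have d0 : 0 < d by rewrite lt_min divr_gt0; lra.
have dc : d <= c by rewrite ge_min lexx.
have dK : d * K <= c by rewrite -ler_pdivlMr // ge_min lexx orbT.
exists d, r; split=> [|t s s' td sd s'd]; first by rewrite d0; lra.
suff key (u : R) : 0 < u < d * t ^+ r ->
    Num.sg (('X * q + a%:P) * 'X^e).[u%:P].[t] = Num.sg a.[t].
  by rewrite !key.
move=> /andP[u0 ud].
have tr1 : t ^+ r <= 1 by rewrite exprn_ile1; lra.
have tr0 : 0 < t ^+ r by rewrite exprn_gt0; lra.
have u1 : 0 <= u <= 1.
  have : d * t ^+ r <= 1 * 1 by rewrite ler_pM; lra.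
  lra.
rewrite hornerM hornerXn hornerM horner_exp hornerC sgrM sgrX (gtr0_sg u0) expr1n.
rewrite mulr1 !hornerE.
set v := q.[_].[_]; have uv : `|u * v| < `|a.[t]|.
  have /ac/lt_le_trans : 0 < t <= c by lra.
  apply; rewrite normrM gtr0_norm //.
  have t01 : 0 <= t <= 1 by lra.
  have := qK t u t01 u1; rewrite -/v => vK.
  have h1 : u * `|v| <= u * K by rewrite ler_wpM2l // ltW.
  have h2 : u * K < d * t ^+ r * K by rewrite ltr_pM2r.
  have h3 : d * K * t ^+ r <= c * t ^+ r by rewrite ler_pM2r.
  by lra.
move: uv; case: (ltrgt0P a.[t]) => [a1|a1|a1].
- by rewrite ltr_norml => uv; rewrite !gtr0_sg //; lra.
- by rewrite ltr_norml => uv; rewrite !ltr0_sg //; lra.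
- by rewrite normr_lt0.
Qed.

Lemma rterm_poly2 (R : realFieldType) (u : GRing.term R) : GRing.rterm u ->
  exists p : {poly {poly R}},
    forall t s : R, GRing.eval [:: t; s] u = p.[s%:P].[t].
Proof.
elim: u => [i|a|k|u1 IH1 u2 IH2|u IH|u IH k|u1 IH1 u2 IH2|u IH|u IH k] //=.
- case: i => [|[|i]] _.
  + by exists ('X%:P) => t s /=; rewrite hornerC hornerX.
  + by exists 'X => t s /=; rewrite hornerX hornerC.
  + by exists 0 => t s /=; rewrite nth_nil !horner0.
- by exists (a%:P%:P) => t s; rewrite !hornerC.
- by exists (k%:R%:P%:P) => t s; rewrite !hornerC.
- move=> /andP[/IH1[p pE] /IH2[q qE]]; exists (p + q) => t s.
  by rewrite !hornerD pE qE.
- by move=> /IH[p pE]; exists (- p) => t s; rewrite !hornerN pE.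
- by move=> /IH[p pE]; exists (p *+ k) => t s; rewrite !hornerMn pE.
- move=> /andP[/IH1[p pE] /IH2[q qE]]; exists (p * q) => t s.
  by rewrite !hornerM pE qE.
- by move=> /IH[p pE]; exists (p ^+ k) => t s; rewrite !horner_exp pE.
Qed.

(** The sets [s < c * t ^ r] shrink with [c] and grow with [r], so two such
    germs of neighbourhoods of the axis [s = 0] always contain a third one. *)
Lemma shrink_range (R : realFieldType) (c1 c2 : R) (r1 r2 : nat) :
  0 < c1 <= 1 -> 0 < c2 <= 1 ->
  exists (c : R) (r : nat), [/\ 0 < c <= 1, c <= c1, c <= c2 &
    forall t : R, 0 < t <= c -> c * t ^+ r <= c1 * t ^+ r1 /\
                            c * t ^+ r <= c2 * t ^+ r2].
Proof.
move=> h1 h2; exists (Num.min c1 c2), (maxn r1 r2); set c := Num.min c1 c2.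
have c0 : 0 < c by rewrite lt_min; lra.
have cc1 : c <= c1 by rewrite ge_min lexx.
have cc2 : c <= c2 by rewrite ge_min lexx orbT.
split=> // [|t t0]; first by rewrite c0; lra.
have tr r : 0 <= t ^+ r by rewrite exprn_ge0; lra.
have tX k l : (k <= l)%N -> t ^+ l <= t ^+ k by apply: ler_wiXn2l; lra.
by split; apply: ler_pM => //; rewrite ?(ltW c0) ?tX ?leq_maxl ?leq_maxr.
Qed.

Lemma qf_stable (R : realFieldType) (f : formula R) : qf_form f -> rformula f ->
  exists (c : R) (r : nat), 0 < c <= 1 /\
    forall t s s' : R, 0 < t <= c -> 0 < s < c * t ^+ r -> 0 < s' < c * t ^+ r ->
    qf_eval [:: t; s] f = qf_eval [:: t; s'] f.
Proof.
have atom (u1 u2 : GRing.term R) : GRing.rterm u1 -> GRing.rterm u2 ->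
  exists (c : R) (r : nat), 0 < c <= 1 /\
    forall t s s' : R, 0 < t <= c -> 0 < s < c * t ^+ r -> 0 < s' < c * t ^+ r ->
    Num.sg (GRing.eval [:: t; s] u2 - GRing.eval [:: t; s] u1) =
    Num.sg (GRing.eval [:: t; s'] u2 - GRing.eval [:: t; s'] u1).
  move=> /rterm_poly2[p pE] /rterm_poly2[q qE].
  have [c [r [c01 cP]]] := poly2_sign_stable (q - p).
  exists c, r; split=> // t s s' tc sc sc'.
  by rewrite !pE !qE -!hornerN -!hornerD; apply: cP.
have bin (f1 f2 : formula R) (op : bool -> bool -> bool) :
    (exists (c : R) (r : nat), 0 < c <= 1 /\
    forall t s s' : R, 0 < t <= c -> 0 < s < c * t ^+ r -> 0 < s' < c * t ^+ r ->
    qf_eval [:: t; s] f1 = qf_eval [:: t; s'] f1) ->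
    (exists (c : R) (r : nat), 0 < c <= 1 /\
    forall t s s' : R, 0 < t <= c -> 0 < s < c * t ^+ r -> 0 < s' < c * t ^+ r ->
    qf_eval [:: t; s] f2 = qf_eval [:: t; s'] f2) ->
  exists (c : R) (r : nat), 0 < c <= 1 /\
    forall t s s' : R, 0 < t <= c -> 0 < s < c * t ^+ r -> 0 < s' < c * t ^+ r ->
    op (qf_eval [:: t; s] f1) (qf_eval [:: t; s] f2) =
    op (qf_eval [:: t; s'] f1) (qf_eval [:: t; s'] f2).
  move=> [c1 [r1 [c01 c1P]]] [c2 [r2 [c02 c2P]]].
  have [c [r [c0 cc1 cc2 cP]]] := shrink_range r1 r2 c01 c02.
  exists c, r; split=> // t s s' tc sc sc'; have [h1 h2] := cP _ tc.
  by rewrite (c1P t s s') 1?(c2P t s s') //; lra.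
elim: f => //=.
- by move=> b _ _; exists 1, 0%N; split; rewrite ?ltr01 ?lexx.
- move=> u1 u2 _ /andP[h1 h2]; have [c [r [c01 cP]]] := atom _ _ h1 h2.
  exists c, r; split=> // t s s' tc sc sc'.
  rewrite ![GRing.eval _ u1 == _]eq_sym -!(subr_eq0 _ (GRing.eval _ u1)).
  by rewrite -!(sgr_eq0 (_ - _)) (cP t s s').
- move=> u1 u2 _ /andP[h1 h2]; have [c [r [c01 cP]]] := atom _ _ h1 h2.
  exists c, r; split=> // t s s' tc sc sc'.
  by rewrite -!(subr_gt0 (GRing.eval _ u1)) -!(sgr_gt0 (_ - _)) (cP t s s').
- move=> u1 u2 _ /andP[h1 h2]; have [c [r [c01 cP]]] := atom _ _ h1 h2.
  exists c, r; split=> // t s s' tc sc sc'.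
  by rewrite -!(subr_ge0 (GRing.eval _ u1)) -!(sgr_ge0 (_ - _)) (cP t s s').
- move=> f1 IH1 f2 IH2 /andP[q1 q2] /andP[r1 r2].
  exact: (bin f1 f2 andb (IH1 q1 r1) (IH2 q2 r2)).
- move=> f1 IH1 f2 IH2 /andP[q1 q2] /andP[r1 r2].
  exact: (bin f1 f2 orb (IH1 q1 r1) (IH2 q2 r2)).
- move=> f1 IH1 f2 IH2 /andP[q1 q2] /andP[r1 r2].
  exact: (bin f1 f2 implb (IH1 q1 r1) (IH2 q2 r2)).
- move=> f IH q1 r1; exact: (bin f f (fun b _ => ~~ b) (IH q1 r1) (IH q1 r1)).
Qed.

(** Quantifier elimination turns every first order condition on [(t, s)] into
    finitely many polynomial sign conditions, which are stable near [s = 0]. *)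
Lemma definable_stable (R : rcfType) (f : formula R) : rformula f ->
  exists (c : R) (r : nat), 0 < c <= 1 /\
    forall t s s' : R, 0 < t <= c -> 0 < s < c * t ^+ r -> 0 < s' < c * t ^+ r ->
    holds [:: t; s] f -> holds [:: t; s'] f.
Proof.
move=> rf; have elimP := quantifier_elim_rformP
  (@qe_rcf.wf_QE_wproj R) (@qe_rcf.valid_QE_wproj R).
have /andP[qf' rf'] := quantifier_elim_wf (@qe_rcf.wf_QE_wproj R) rf.
have [c [r [c01 cP]]] := qf_stable qf' rf'.
exists c, r; split=> // t s s' tc sc sc' /(elimP _ _ rf) h.
by apply/(elimP _ _ rf); rewrite (cP t s' s).
Qed.

Lemma holds_exists (R : realDomainType) (f : formula R) k e :
  holds e (foldr Exists f (iota (size e) k)) <->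
  exists2 v, size v = k & holds (e ++ v) f.
Proof.
elim: k e => [|k IH] e /=.
  split=> [h|[v /size0nil->]]; last by rewrite cats0.
  by exists [::]; rewrite ?cats0.
have step x : holds (set_nth 0 e (size e) x)
    (foldr Exists f (iota (size e).+1 k)) <->
    exists2 v, size v = k & holds (e ++ x :: v) f.
  rewrite set_nthE ltnn subnn /=.
  have := IH (e ++ [:: x]); rewrite size_cat addn1 => ->.
  by split=> -[v sv h]; exists v; rewrite // -?catA // in h *; rewrite -catA.
split=> [[x /step[v sv h]]|[[|x v] //= [sv] h]].
  by exists (x :: v) => //=; rewrite sv.
by exists x; apply/step; exists v.
Qed.

Lemma holds_forall (R : realDomainType) (f : formula R) k e :
  holds e (foldr Forall f (iota (size e) k)) <->
  forall v, size v = k -> holds (e ++ v) f.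
Proof.
elim: k e => [|k IH] e /=.
  split=> [h v /size0nil->|h]; first by rewrite cats0.
  by rewrite -[e]cats0; apply: h.
have step x : holds (set_nth 0 e (size e) x)
    (foldr Forall f (iota (size e).+1 k)) <->
    forall v, size v = k -> holds (e ++ x :: v) f.
  rewrite set_nthE ltnn subnn /=.
  have := IH (e ++ [:: x]); rewrite size_cat addn1 => ->.
  by split=> h v sv; have := h v sv; rewrite -catA.
split=> [h [|x v] //= [sv]|h x]; first by have /step := h x; apply.
by apply/step => v sv; apply: h => /=; rewrite sv.
Qed.

Lemma holds_all (R : realDomainType) (I : finType) (F : I -> formula R) e :
  holds e (\big[And/Bool true]_i F i) <-> forall i, holds e (F i).
Proof.
suff h s : holds e (\big[And/Bool true]_(i <- s) F i) <->
    forall i, i \in s -> holds e (F i).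
  by rewrite h; split=> H i *; apply: H; rewrite ?mem_index_enum.
elim: s => [|i s IH]; first by rewrite big_nil.
rewrite big_cons /= IH; split=> [[h1 h2] j|h].
  by rewrite inE => /predU1P[->|/h2].
by split=> [|j js]; apply: h; rewrite inE ?eqxx ?js ?orbT.
Qed.

Lemma rformula_all (R : realDomainType) (I : finType) (F : I -> formula R) :
  (forall i, rformula (F i)) -> rformula (\big[And/Bool true]_i F i).
Proof. by move=> h; elim/big_ind: _ => //= f1 f2 -> ->. Qed.

Lemma rformula_exists (R : realDomainType) (f : formula R) s :
  rformula (foldr Exists f s) = rformula f.
Proof. by elim: s. Qed.

Lemma rformula_forall (R : realDomainType) (f : formula R) s :
  rformula (foldr Forall f s) = rformula f.
Proof. by elim: s. Qed.

Definition mpoly_term (R : realType) (n : nat) (k : nat) (p : {mpoly R[n]}) :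
    GRing.term R :=
  \big[GRing.Add/GRing.NatConst _ 0]_(m <- msupp p)
    GRing.Mul (GRing.Const p@_m)
      (\big[GRing.Mul/GRing.NatConst _ 1]_(i < n)
        GRing.Exp (GRing.Var _ (k + i)) (m i)).

Lemma rterm_mpoly_term (R : realType) n k (p : {mpoly R[n]}) :
  GRing.rterm (mpoly_term k p).
Proof.
rewrite /mpoly_term; elim/big_ind: _ => //= [x y -> -> //|m _].
by elim/big_ind: _ => //= x y -> ->.
Qed.

Lemma eval_mpoly_term (R : realType) n k (p : {mpoly R[n]}) e :
  GRing.eval e (mpoly_term k p) = p.@[fun i => e`_(k + i)].
Proof.
rewrite mevalE /mpoly_term.
rewrite (big_morph (GRing.eval e) (id1 := 0) (op1 := +%R)) //.
apply: eq_bigr => m _ /=; congr (_ * _).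
by rewrite (big_morph (GRing.eval e) (id1 := 1) (op1 := *%R)).
Qed.

End SmallParameter.

(** * Polynomials on boxes *)

Section BoxContinuity.
Variables (R : realType) (n : nat) (a : R) (a1 : 1 <= a).
Implicit Types (p : {mpoly R[n]}) (x y : 'I_n -> R).

(** Rescaling the box to the unit cube, where the coefficients alone give bounds
    and Lipschitz constants. *)
Lemma box_scale p : exists D A (q : {mpoly R[n]}), l1_bound D A q /\
  forall x, p.@[x] = q.@[fun i => a^-1 * x i].
Proof.
pose q := p \mPo [tuple a *: 'X_i | i < n].
have [D [A qA]] := l1_bound_ex q; exists D, A, q; split=> // x.
rewrite /q comp_mpoly_meval; apply: meval_eq => i.
by rewrite tnth_mktuple mevalZ mevalXU mulVKf // lt0r_neq0 // (lt_le_trans _ a1).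
Qed.

Lemma box_scale_le1 x : (forall i, `|x i| <= a) -> forall i, `|a^-1 * x i| <= 1.
Proof.
move=> xa i; have a0 : 0 < a by rewrite (lt_le_trans _ a1).
by rewrite normrM gtr0_norm ?invr_gt0 // ler_pdivrMl // mulr1.
Qed.

Lemma box_bounded p :
  exists2 B, 0 <= B & forall x, (forall i, `|x i| <= a) -> `|p.@[x]| <= B.
Proof.
have [D [A [q [qA pq]]]] := box_scale p.
exists A => [|x xa]; first exact: l1_bound_ge0 qA.
by rewrite pq; apply: l1_bound_eval qA _; apply: box_scale_le1.
Qed.

Lemma box_lipschitz p : exists2 L, 0 <= L & forall x y (e : R),
  (forall i, `|x i| <= a) -> (forall i, `|y i| <= a) -> 0 <= e ->
  (forall i, `|x i - y i| <= e) -> `|p.@[x] - p.@[y]| <= L * e.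
Proof.
have [D [A [q [qA pq]]]] := box_scale p.
exists (D%:R * A) => [|x y e xa ya e0 xye].
  by rewrite mulr_ge0 ?ler0n ?(l1_bound_ge0 qA).
rewrite !pq; apply: l1_bound_lipschitz qA _ _ e0 _ => [||i].
- exact: box_scale_le1.
- exact: box_scale_le1.
rewrite -mulrBr normrM (le_trans _ (xye i)) // -[leRHS]mul1r ler_wpM2r //.
by rewrite ger0_norm ?invr_ge0 ?invf_le1 ?(le_trans _ a1) // (lt_le_trans _ a1).
Qed.

Lemma box_positive_near p x : (forall i, `|x i| <= a) -> 0 < p.@[x] ->
  exists2 d : R, 0 < d & forall y, (forall i, `|y i| <= a) ->
    (forall i, `|x i - y i| < d) -> d <= p.@[y].
Proof.
move=> xa px; have [L L0 pL] := box_lipschitz p; pose v := p.@[x] / 2.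
have v0 : 0 < v by rewrite divr_gt0.
have L1 : 0 < L + 1 by rewrite ltr_wpDl.
pose d := Num.min v (v / (L + 1)).
have d0 : 0 < d by rewrite lt_min v0 divr_gt0.
have dv : d <= v by rewrite ge_min lexx.
have Ldv : L * d <= v.
  have : d <= v / (L + 1) by rewrite ge_min lexx orbT.
  by rewrite ler_pdivlMr // => h; lra.
exists d => // y ya xyd; have := pL x y d xa ya (ltW d0) (fun i => ltW (xyd i)).
rewrite ler_norml => /andP[_ h].
have v2 : p.@[x] = v + v by rewrite /v; lra.
by move: h; rewrite v2; lra.
Qed.

End BoxContinuity.

(** * The Lojasiewicz inequality *)

Section Lojasiewicz.
Import ordered_qelim.ord SmallParameter.
Variables (R : realType) (n m : nat) (g : m.-tuple {mpoly R[n]}).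

Let dist2 (x y : 'I_n -> R) := \sum_(i < n) (x i - y i) ^+ 2.

(** The relation between distance and violation that quantifier elimination is
    applied to; the Lojasiewicz inequality says that it fails below a curve
    [s = c t ^ r]. *)
Definition far_almost_feasible (t s : R) := exists x : 'I_n -> R,
  [/\ forall i, `|x i| <= 1, forall j, - s <= (tnth g j).@[x]
    & forall y, Sset g y -> t <= dist2 x y].

(** In the formulas below [t] and [s] are the variables [0] and [1]; the
    coordinates of [x] come next, then those of [y]. *)
Definition dist2_term : GRing.term R :=
  \big[GRing.Add/GRing.NatConst _ 0]_(i < n)
    GRing.Exp (GRing.Add (GRing.Var _ (2 + i))
                         (GRing.Opp (GRing.Var _ (2 + n + i)))) 2.

Definition far_matrix : formula R :=
  Implies (\big[And/Bool true]_(j < m)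
             Le (GRing.Const 0) (mpoly_term (2 + n) (tnth g j)))
          (Le (GRing.Var _ 0) dist2_term).

Definition far_body : formula R :=
  And (\big[And/Bool true]_(i < n)
         And (Le (GRing.Const (-1)) (GRing.Var _ (2 + i)))
             (Le (GRing.Var _ (2 + i)) (GRing.Const 1)))
  (And (\big[And/Bool true]_(j < m)
          Le (GRing.Opp (GRing.Var _ 1)) (mpoly_term 2 (tnth g j)))
       (foldr Forall far_matrix (iota (2 + n) n))).

Definition far_formula : formula R := foldr Exists far_body (iota 2 n).

Lemma rformula_far : rformula far_formula.
Proof.
rewrite rformula_exists /= rformula_forall /=.
rewrite !rformula_all //=; [|by move=> j; rewrite rterm_mpoly_term..].
by rewrite /dist2_term; elim/big_ind: _ => //= x y -> ->.
Qed.

Lemma far_formulaP t s :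
  holds [:: t; s] far_formula <-> far_almost_feasible t s.
Proof.
rewrite /far_formula.
have := @holds_exists R _ n [:: t; s]; rewrite /= => ->.
pose env u v : seq R := [:: t, s & u ++ v].
have nx u v (i : 'I_n) : size u = n -> (env u v)`_(2 + i) = u`_i.
  by move=> su; rewrite /env /= nth_cat su ltn_ord.
have ny u v (i : 'I_n) : size u = n -> (env u v)`_(2 + n + i) = v`_i.
  move=> su; have -> : (2 + n + i = (size u + i).+2)%N by rewrite su.
    by rewrite /env /= nth_cat ltnNge leq_addr /= addKn.
pose vec (x : 'I_n -> R) := [seq x i | i <- enum 'I_n].
have svec x : size (vec x) = n by rewrite size_map size_enum_ord.
have nvec x (i : 'I_n) : (vec x)`_i = x i.
  by rewrite (nth_map i) ?size_enum_ord // nth_ord_enum.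
have body u : size u = n ->
  holds [:: t, s & u] far_body <->
  [/\ forall i : 'I_n, `|u`_i| <= 1, forall j, - s <= (tnth g j).@[fun i => u`_i]
    & forall y, Sset g y -> t <= dist2 (fun i => u`_i) y].
  move=> su; rewrite /far_body /=.
  have := holds_forall far_matrix n [:: t, s & u].
  rewrite [size _]/= su -[n.+2]/(2 + n)%N => ->.
  rewrite !holds_all /=.
  have evy v :
      (forall j, holds (env u v)
         (Le (GRing.Const 0) (mpoly_term (2 + n) (tnth g j)))) <->
      Sset g (fun i => v`_i).
    have ev j : GRing.eval (env u v) (mpoly_term (2 + n) (tnth g j)) =
        (tnth g j).@[fun i => v`_i].
      by rewrite eval_mpoly_term; apply: meval_eq => i; apply: ny.
    by split=> h j; have := h j; rewrite /= ev.
  have evd v : GRing.eval (env u v) dist2_term =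
      dist2 (fun i => u`_i) (fun i => v`_i).
    rewrite /dist2_term.
    rewrite (big_morph (GRing.eval (env u v)) (id1 := 0) (op1 := +%R)) //.
    by apply: eq_bigr => i _ /=; rewrite -(nx u v i su) -(ny u v i su).
  split=> [[h1 [h2 h3]]|[h1 h2 h3]]; split.
  - by move=> i; rewrite ler_norml; have [] := h1 i => -> ->.
  - by move=> j; have := h2 j; rewrite eval_mpoly_term.
  - move=> y Sy; have := h3 (vec y) (svec y).
    have Sv : Sset g (fun i => (vec y)`_i).
      by move=> j; rewrite (meval_eq (v2 := y)) // => i; rewrite nvec.
    rewrite -/(env u (vec y)) holds_all => /(_ (iffRL (evy (vec y)) Sv)).
    rewrite evd /= => h; apply: le_trans h _; apply: ler_sum => i _.
    by rewrite nvec.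
  - by move=> i; have := h1 i; rewrite ler_norml => /andP[].
  - split=> [j|v sv]; first by rewrite eval_mpoly_term; apply: h2.
    rewrite -/(env u v) holds_all => /(evy v) Sv.
    by rewrite evd; apply: h3.
split=> [[u su /(body u su)[h1 h2 h3]]|[x [h1 h2 h3]]].
  by exists (fun i => u`_i).
exists (vec x) => //; apply/body => //.
have xE : (fun i : 'I_n => (vec x)`_i) =1 x by move=> i; apply: nvec.
split=> [i|j|y Sy]; first by rewrite nvec.
  by rewrite (meval_eq _ xE).
rewrite (le_trans (h3 y Sy)) //; apply: ler_sum => i _.
by rewrite nvec.
Qed.

(** Points of the cube close to a point of [S(g)] at squared distance less than
    [t] are excluded, and all other points violate a constraint; compactness makes
    the violation uniform. *)
Lemma far_infeasible (t : R) : 0 < t ->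
  exists2 d : R, 0 < d & forall s, s < d -> ~ far_almost_feasible t s.
Proof.
move=> t0; pose Q (x : 'I_n -> R) (d : R) :=
  (exists2 y, Sset g y & dist2 x y < t) \/ (exists j, (tnth g j).@[x] <= - d).
have [x d d' dd [[y Sy yt]|[j jd]]|x x1|d d0 dQ] :=
  @Compactness.box_uniform R n 1 Q.
- by left; exists y.
- by right; exists j; lra.
- have [[y Sy yt]|noy] := boolp.pselect (exists2 y, Sset g y & dist2 x y < t).
    pose p : {mpoly R[n]} := t%:MP - \sum_(i < n) ('X_i - (y i)%:MP) ^+ 2.
    have pE z : p.@[z] = t - dist2 z y.
      rewrite mevalB mevalC; congr (t - _); rewrite raddf_sum /=.
      by apply: eq_bigr => i _; rewrite rmorphXn /= mevalB mevalXU mevalC.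
    have [|d d0 dP] := @box_positive_near R n 1 (lexx _) p x x1.
      by rewrite pE subr_gt0.
    exists d => // z z1 zd; left; exists y => //.
    by have := dP z z1 zd; rewrite pE; lra.
  have [j gj] : exists j, (tnth g j).@[x] < 0.
    apply: boolp.contrapT => nog; apply: noy; exists x => [j|].
      by rewrite leNgt; apply/negP => gj; apply: nog; exists j.
    by rewrite /dist2 big1 // => i _; rewrite subrr expr0n.
  have [|d d0 dP] := @box_positive_near R n 1 (lexx _) (- tnth g j) x x1.
    by rewrite mevalN oppr_gt0.
  exists d => // z z1 zd; right; exists j.
  by have := dP z z1 zd; rewrite mevalN; lra.
- exists d => // s sd [x [x1 xs xS]].
  case: (dQ x x1) => [[y Sy]|[j]]; first by have := xS y Sy; lra.
  by have := xs j; lra.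
Qed.

(** For each [t], compactness makes [far_almost_feasible t s] false for small
    [s]; by quantifier elimination its truth value does not change as long as
    [s < c t ^ r], so it is false up to there. *)
Lemma lojasiewicz : exists (c : R) (r : nat), 0 < c /\
  forall (x : 'I_n -> R) (t : R), (forall i, `|x i| <= 1) -> 0 < t <= 1 ->
    (forall y, Sset g y -> t <= dist2 x y) ->
    exists j, (tnth g j).@[x] <= - (c * t ^+ r).
Proof.
have [c [r [/andP[c0 c1] cP]]] := definable_stable rformula_far.
exists (c / 2 * c ^+ r), r; split=> [|x t x1 /andP[t0 t1] xS].
  by rewrite mulr_gt0 ?exprn_gt0 ?divr_gt0.
pose u := Num.min t c; pose s := c / 2 * u ^+ r.
have u0 : 0 < u by rewrite lt_min t0.
have ut : u <= t by rewrite ge_min lexx.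
have uc : u <= c by rewrite ge_min lexx orbT.
have ur : 0 < u ^+ r by rewrite exprn_gt0.
have cu : 0 < c * u ^+ r by rewrite mulr_gt0.
have s0 : 0 < s by rewrite mulr_gt0 ?divr_gt0.
have cut : c * t <= u.
  by rewrite le_min -{2}[t]mul1r -{3}[c]mulr1 !ler_pM // ltW.
have ts : c / 2 * c ^+ r * t ^+ r <= s.
  rewrite -mulrA -exprMn ler_wpM2l ?divr_ge0 ?(ltW c0) //.
  by rewrite lerXn2r ?nnegrE ?mulr_ge0 // ltW.
apply: boolp.contrapT => nog.
have far_s : far_almost_feasible u s.
  exists x; split=> // [j|y Sy]; last by rewrite (le_trans ut) ?xS.
  rewrite leNgt; apply/negP => gj; apply: nog; exists j.
  by rewrite (le_trans (ltW gj)) // lerN2.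
have [d d0 dP] := far_infeasible u0.
pose s' := Num.min s (d / 2).
have s'0 : 0 < s' by rewrite lt_min s0 divr_gt0.
have s's : s' <= s by rewrite ge_min lexx.
have s'd : s' <= d / 2 by rewrite ge_min lexx orbT.
have sc : s < c * u ^+ r by rewrite /s; lra.
apply: (dP s'); first by lra.
apply/far_formulaP; apply: (cP u s s').
- by rewrite u0.
- by rewrite s0.
- by rewrite s'0 (le_lt_trans s's).
- exact/far_formulaP.
Qed.

End Lojasiewicz.

(** * The qualitative theorem *)

Section Putinar.
Variables (R : realType) (n m : nat) (g : m.-tuple {mpoly R[n]}).
Implicit Types (f p : {mpoly R[n]}).

Lemma exists_nat_ge (x : R) : exists N : nat, x <= N%:R.
Proof.
exists (Num.truncn (`|x|)).+1; apply: le_trans (ler_norm x) _.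
by have /andP[_ /ltW] := truncn_itv (normr_ge0 x).
Qed.

Lemma finite_uniform_degree (T : finType) (F : T -> {mpoly R[n]}) :
  (forall i, quadratic_module g (F i)) -> exists K, forall i, qmodule_deg g K (F i).
Proof.
move=> Fg; have {}Fg i := qmodule_deg_ex (Fg i).
have [K KP] := boolp.choice Fg.
exists (\max_i K i)%N => i; apply: qmodule_degW (KP i).
exact: leq_bigmax.
Qed.

(** Rescaled constraints have all the bounds that [putinar_bounded] asks for. *)
Lemma normalized_constraints (a : R) : 1 <= a -> exists (gamma : R) (e : nat),
  [/\ 0 < gamma, forall i, l1_bound e 1 (gamma^-1 *: tnth g i),
      forall i, (msize (tnth g i) <= e.+1)%N
    & forall (x : 'I_n -> R) i, (forall j, `|x j| <= a) ->
        `|(gamma^-1 *: tnth g i).@[x]| <= 1].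
Proof.
move=> a1.
pose A i : R := \sum_(u <- msupp (tnth g i)) `|(tnth g i)@_u|.
have bA i : l1_bound (msize (tnth g i)).-1 (A i) (tnth g i).
  exact: l1_bound_msupp.
have /boolp.choice[B BP] : forall i, exists b : R, 0 <= b /\
    forall x : 'I_n -> R, (forall j, `|x j| <= a) -> `|(tnth g i).@[x]| <= b.
  by move=> i; have [b b0 bP] := box_bounded a1 (tnth g i); exists b.
have A0 i : 0 <= A i by apply: l1_bound_ge0 (bA i).
pose gamma := 1 + \sum_i (A i + B i).
have s0 (P : pred 'I_m) : 0 <= \sum_(i | P i) (A i + B i).
  by apply: sumr_ge0 => i _; rewrite addr_ge0 // (BP i).1.
have g1 : 0 < gamma by have := s0 xpredT; rewrite /gamma; lra.
have AB i : A i + B i <= gamma.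
  rewrite /gamma (bigD1 i) //=; have := s0 (fun j => j != i); lra.
exists gamma, (\max_i msize (tnth g i))%N; split=> // [i|i|x i xa].
- apply: (@l1_boundW _ _ (msize (tnth g i)).-1 _ (`|gamma^-1| * A i)).
  + by apply: leq_trans (leq_pred _) _; apply: leq_bigmax.
  + rewrite gtr0_norm ?invr_gt0 // ler_pdivrMl // mulr1.
    by have := AB i; have := (BP i).1; lra.
  + exact: l1_boundZ.
- by apply: leqW; apply: leq_bigmax.
- rewrite mevalZ normrM gtr0_norm ?invr_gt0 // ler_pdivrMl // mulr1.
  have := (BP i).2 x xa; have := AB i; have := A0 i; lra.
Qed.

(** Putinar's theorem, from the quantitative step by taking every parameter large
    enough; here the bound [delta] comes from compactness alone. *)
Lemma putinar f : archimedean g -> (forall x, Sset g x -> 0 < f.@[x]) ->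
  quadratic_module g f.
Proof.
move=> /archimedean_box_products[a a1 aP] fpos.
have a0 : 0 < a by rewrite (lt_le_trans _ a1).
have [K0 K0P] : exists K0, forall de : {ffun 'I_n -> bool} * {ffun 'I_n -> bool},
    qmodule_deg g K0 (face_product a (fun i => de.1 i : nat) (fun i => de.2 i : nat)).
  by apply: finite_uniform_degree => de; apply: aP.
have [gamma [e [g0 ub ue u1]]] := normalized_constraints a1.
pose Q (x : 'I_n -> R) (d : R) :=
  d <= f.@[x] \/ exists i, (gamma^-1 *: tnth g i).@[x] <= - d.
have [x d d' dd [fd|[i id]]|x xa|d d0 dQ] := @Compactness.box_uniform R n a Q.
- by left; lra.
- by right; exists i; lra.
- have [xS|] := boolp.pselect (Sset g x).
    have [d d0 dP] := box_positive_near a1 xa (fpos x xS).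
    by exists d => // y ya xyd; left; apply: dP.
  move=> /boolp.existsNP[i /negP]; rewrite -ltNge => gi.
  have [|d d0 dP] := @box_positive_near R n a a1 (- (gamma^-1 *: tnth g i)) x xa.
    by rewrite mevalN mevalZ oppr_gt0 pmulr_rlt0 // invr_gt0.
  exists d => // y ya xyd; right; exists i.
  by have := dP y ya xyd; rewrite mevalN; lra.
have [B B0 BP] := box_bounded a1 f.
have [D0 [A0 fA0]] := l1_bound_ex f.
pose A := A0 + B; have A00 := l1_bound_ge0 fA0.
pose lambda := (A + d) / d.
have l0 : 0 <= lambda by rewrite divr_ge0 ?(ltW d0) // /A; lra.
have [k kP] := exists_nat_ge (lambda * m%:R / d).
pose D := (D0 + (2 * k.+1).+1 * e)%N.
pose X := D%:R ^+ 2 * ((A + lambda * (m%:R * ((1 + 1) ^+ (2 * k.+1) * 1))) *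
  (3 * a) ^+ D).
have [N NP] := exists_nat_ge (X / (d / 2)).
have dN : 0 < d / 2 by rewrite divr_gt0.
have [s [s1 _ s2]] : qmodule_deg g (n * (N + D).+1 + K0 + D) f.
  apply: (@putinar_bounded _ _ _ g a gamma A d d lambda 1 K0 D e k.+1) => //.
  - by move=> de ee; apply: (K0P (de, ee)).
  - by apply: l1_boundW fA0; rewrite ?leq_addr // /A; lra.
  - by rewrite leq_addl.
  - by move=> x xa; rewrite (le_trans (BP x xa)) // /A; lra.
  - exact: ltW.
  - exact: ltW.
  - by rewrite /lambda divfK ?lt0r_neq0.
  - rewrite -ler_pdivrMl // mulrC (le_trans kP) // ler_nat //.
  - by rewrite leqW // leq_addl.
  - rewrite -/X -ler_pdivrMl // mulrC (le_trans NP) // ler_nat.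
    by rewrite leqW // leq_addr.
by exists s.
Qed.

End Putinar.

(** * The degree bound *)

Section Growth.
Variable R : realType.

(** For [B <= 2] the left hand side is bounded; for [B >= 2] the factor
    [2 ^ (Q - p)] in [B ^ Q >= B ^ p * 2 ^ (Q - p)] absorbs the constant [F]. *)
Lemma growth (C F : R) (p : nat) : 0 <= C -> 0 <= F ->
  exists c : R, 0 < c /\ forall B : R, 0 <= B ->
    C * expR (F * B ^+ p) <= c * expR (B `^ c).
Proof.
move=> C0 F0; have [Q1 Q1P] := exists_nat_ge F.
have [Q2 Q2P] := exists_nat_ge (C * expR (F * 2 ^+ p)).
pose Q := (p + Q1 + Q2).+1; exists Q%:R; split=> [|B B0]; first by rewrite ltr0n.
have e1 (x : R) : 0 <= x -> 1 <= expR x by move=> x0; rewrite -expR0 ler_expR.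
have CQ : C <= Q%:R.
  apply: (@le_trans _ _ (C * expR (F * 2 ^+ p))).
    by rewrite -{1}[C]mulr1 ler_wpM2l // e1 // mulr_ge0 // exprn_ge0.
  by rewrite (le_trans Q2P) // ler_nat leqW // leq_addl.
rewrite powR_mulrn //; have [B2|B2] := lerP B 2.
  apply: (@le_trans _ _ Q%:R).
    apply: (@le_trans _ _ (C * expR (F * 2 ^+ p))).
      rewrite ler_wpM2l // ler_expR ler_wpM2l // lerXn2r ?nnegrE //.
    by rewrite (le_trans Q2P) // ler_nat leqW // leq_addl.
  by rewrite -{1}[Q%:R]mulr1 ler_wpM2l // e1 // exprn_ge0.
rewrite ler_pM ?expR_ge0 // ler_expR /Q -addnA -addnS exprD mulrC.
rewrite ler_wpM2l ?exprn_ge0 // (le_trans Q1P) //.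
apply: (@le_trans _ _ (2 ^+ (Q1 + Q2).+1)).
  by rewrite -natrX ler_nat (leq_trans _ (ltnW (ltn_expl _ _))) // leqW // leq_addr.
by rewrite lerXn2r ?nnegrE // ltW.
Qed.

Lemma natr_pow2_le_expR (k : nat) : (2 ^ k)%:R <= expR (k%:R : R).
Proof.
rewrite natrX -[k%:R]mulr1 expRM_natl lerXn2r ?nnegrE ?expR_ge0 //.
by have := expR_ge1Dx (1 : R); lra.
Qed.

(** Every factor of the number of nodes is at most a power of [2] whose exponent
    is linear in [K]. *)
Lemma degree_estimate (n K0 E K D : nat) : (D = E * K)%N ->
  (n * (8 * D ^ 2 * K * 4 ^ K * 3 ^ D) + K0 + D <=
     (8 * n + K0 + 1) * 2 ^ ((4 * E + 3) * K))%N.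
Proof.
move=> DE; have D2 : (D <= 2 ^ D)%N by rewrite ltnW // ltn_expl.
have K2 : (K <= 2 ^ K)%N by rewrite ltnW // ltn_expl.
have D3 : (3 ^ D <= 4 ^ D)%N by case: (D) => // k; rewrite leq_exp2r.
have four k : (4 ^ k = (2 ^ k) ^ 2)%N by rewrite -expnM mulnC expnM.
have PE : (2 ^ ((4 * E + 3) * K) =
    (2 ^ D) ^ 2 * 2 ^ K * 4 ^ K * 4 ^ D)%N.
  by rewrite !four -!expnM -!expnD; congr (2 ^ _)%N; rewrite DE; ring.
have h1 : (D ^ 2 * K * 4 ^ K * 3 ^ D <= 2 ^ ((4 * E + 3) * K))%N.
  by rewrite PE !leq_mul // leq_sqr.
have h2 : (D <= 2 ^ ((4 * E + 3) * K))%N.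
  rewrite (leq_trans D2) // leq_exp2l // DE.
  by rewrite leq_mul2r; apply/orP; right; lia.
have h3 : (0 < 2 ^ ((4 * E + 3) * K))%N by rewrite expn_gt0.
move: (2 ^ _)%N h1 h2 h3 => P h1 h2 h3.
have -> : (8 * D ^ 2 * K * 4 ^ K * 3 ^ D = 8 * (D ^ 2 * K * 4 ^ K * 3 ^ D))%N.
  by rewrite !mulnA.
move: (D ^ 2 * _)%N h1 => W h1; nia.
Qed.

End Growth.

(** * Putinar's theorem with a degree bound *)

Section DegreeBound.
Variables (R : realType) (n m : nat) (g : m.-tuple {mpoly R[n]}).
Implicit Types (f : {mpoly R[n]}).

Hypotheses (g_arch : archimedean g)
  (S_cube : Sset g `<=` [set x | forall i : 'I_n, -1 < x i < 1]).

(** On the unit cube the products of faces are positive on [S(g)], so that the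
    qualitative theorem certifies the finitely many squarefree ones. *)
Lemma cube_faces : exists K0, forall d e : {ffun 'I_n -> bool},
  qmodule_deg g K0 (face_product 1 (fun i => d i : nat) (fun i => e i : nat)).
Proof.
have [K0 K0P] : exists K0, forall de : {ffun 'I_n -> bool} * {ffun 'I_n -> bool},
    qmodule_deg g K0 (face_product 1 (fun i => de.1 i : nat) (fun i => de.2 i : nat)).
  apply: finite_uniform_degree => de; apply: putinar => // x /S_cube x1.
  rewrite /face_product rmorph_prod prodr_gt0 // => i _ /=; have := x1 i.
  rewrite rmorphM !rmorphXn rmorphD rmorphB /= mevalC mevalXU => x1i.
  by rewrite mulr_gt0 // exprn_gt0 //; lra.
by exists K0 => d e; apply: (K0P (d, e)).
Qed.

(** Where [f] has dropped to [fstar / 2], the Lipschitz bound keeps the point at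
    distance at least [1 / (2 beta)] from [S(g)], and the Lojasiewicz inequality
    turns this distance into a violated constraint. *)
Lemma low_value_violates : exists (c : R) (r : nat), 0 < c /\
  forall f (d : nat) (A fstar beta : R), l1_bound d A f -> 1 <= beta ->
    0 < fstar -> (forall y, Sset g y -> fstar <= f.@[y]) ->
    d%:R * A <= beta * fstar ->
    forall x : 'I_n -> R, (forall i, `|x i| <= 1) ->
      fstar / 2 <= f.@[x] \/
      exists j, (tnth g j).@[x] <= - (c / beta ^+ r).
Proof.
have [c [r [c0 cP]]] := lojasiewicz g.
exists (c / 4 ^+ r), (2 * r)%N; split; first by rewrite divr_gt0 ?exprn_gt0.
move=> f d A fstar beta fA b1 f0 fS dA x x1.
have b0 : 0 < beta by rewrite (lt_le_trans _ b1).
have [|fx] := lerP (fstar / 2) f.@[x]; [by left | right].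
pose e := (2 * beta)^-1.
have e0 : 0 < e by rewrite invr_gt0 mulr_gt0.
have t01 : 0 < e ^+ 2 <= 1.
  rewrite exprn_gt0 //= exprn_ile1 ?(ltW e0) // invf_le1 ?mulr_gt0 //; lra.
have [y Sy|j gj] := cP x (e ^+ 2) x1 t01.
  rewrite leNgt; apply/negP => near_y.
  have y1 i : `|y i| <= 1 by rewrite ler_norml; have := S_cube Sy i; lra.
  have xye i : `|x i - y i| <= e.
    rewrite -(ler_pXn2r (n := 2)) ?nnegrE ?(ltW e0) // real_normK ?num_real //.
    apply: le_trans (ltW near_y); rewrite (bigD1 i) //= lerDl.
    by apply: sumr_ge0 => j _; apply: sqr_ge0.
  have := l1_bound_lipschitz fA x1 y1 (ltW e0) xye.
  have : d%:R * A * e <= fstar / 2.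
    apply: le_trans (_ : beta * fstar * e <= _); first by rewrite ler_wpM2r // ltW.
    have -> : beta * fstar * e = fstar / 2 by rewrite /e; field; rewrite lt0r_neq0.
    exact: lexx.
  by rewrite ler_norml => h1 /andP[h2 _]; have := fS y Sy; lra.
exists j; rewrite (le_trans gj) // lerN2.
have -> : e ^+ 2 = (4 * beta ^+ 2)^-1.
  by rewrite /e exprVn exprMn; congr (_ * _)^-1; ring.
by rewrite exprVn exprMn invfM mulrA -exprM.
Qed.

(** Everything is polynomial in [beta] except the number [N] of nodes: [delta] is
    a constant times [beta ^ (- r)], hence [lambda m / eps] is at most a constant
    times [beta ^ (r + 1)], and so are [k] and the degree [D] of the polynomial to
    be expanded. Its coefficients are bounded by a quantity exponential in [D], and
    so is [N], which is where the exponential in the final bound comes from. *)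
Lemma putinar_degree : exists (C F : R) (p : nat), [/\ 0 <= C, 0 <= F &
  forall (f : {mpoly R[n]}) (d : nat) (A fstar beta : R),
    l1_bound d A f -> 1 <= beta -> 0 < fstar -> fstar <= A ->
    (forall y, Sset g y -> fstar <= f.@[y]) ->
    A <= beta * fstar -> d%:R <= beta -> d%:R * A <= beta * fstar ->
    truncated_quadratic_module g (C * expR (F * beta ^+ p)) f].
Proof.
have deg_le k l : (0 < k)%N -> ((2 * k).+1 * l <= (3 * l + 1) * k)%N by nia.
have [K0 K0P] := cube_faces.
have [gamma [e [g0 ub ue u1]]] := normalized_constraints g (lexx 1).
have [c [r [c0 cP]]] := low_value_violates.
pose C1 : R := 3 * m%:R * gamma / c + 1.
have C11 : 1 <= C1 by rewrite lerDr divr_ge0 ?mulr_ge0 ?ler0n // ltW.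
pose E := (3 * e + 1)%N; pose M := (8 * n + K0 + 1)%N.
exists M%:R, ((4 * E + 3)%:R * (C1 + 1)), r.+1; split.
- exact: ler0n.
- by rewrite mulr_ge0 ?ler0n //; lra.
move=> f d A fstar beta fA b1 f0 fA' fS Ab db dA.
have b0 : 0 < beta by rewrite (lt_le_trans _ b1).
have bp1 : 1 <= beta ^+ r.+1 by rewrite exprn_ege1.
(* [K] bounds [d], [A / fstar] and [lambda m / eps] at the same time. *)
pose x := C1 * beta ^+ r.+1.
have x1 : 1 <= x by rewrite -[1]mulr1 ler_pM.
have [K [Kx xK]] : exists K : nat, K%:R <= x + 1 /\ x < K%:R.
  have /andP[h1 h2] := truncn_itv (le_trans ler01 x1).
  by exists (Num.truncn x).+1; rewrite h2 -natr1 lerD2r.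
have K0' : (0 < K)%N by rewrite -(ltr_nat R); lra.
have bx : beta <= x.
  apply: (@le_trans _ _ (beta ^+ r.+1)).
    by rewrite exprS ler_peMr ?(ltW b0) // exprn_ege1.
  by rewrite ler_peMl // (le_trans ler01).
have dK : (d <= K)%N by rewrite -(ler_nat R); lra.
have [D DE] : exists D, D = (E * K)%N by eexists.
pose N := (8 * D ^ 2 * K * 4 ^ K * 3 ^ D)%N.
have E0 : (0 < E)%N by rewrite /E addn1.
have DK : (K <= D)%N by rewrite DE leq_pmull.
have D0 : (0 < D)%N by rewrite (leq_trans _ DK).
pose delta := gamma^-1 * (c / beta ^+ r).
have delta0 : 0 < delta by rewrite mulr_gt0 ?invr_gt0 // divr_gt0 // exprn_gt0.
pose eps := fstar / 2.
have eps0 : 0 < eps by rewrite divr_gt0.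
pose lambda := (A + eps) / delta.
have A0 : 0 < A by rewrite (lt_le_trans f0).
have l0 : 0 < lambda by rewrite divr_gt0 // addr_gt0.
have lK : lambda * m%:R <= eps * K%:R.
  have bf : fstar <= beta * fstar by rewrite ler_peMl // ltW.
  have h1 : A + eps <= 3 / 2 * (beta * fstar) by rewrite /eps; lra.
  apply: (@le_trans _ _ (eps * x)); last by rewrite ler_wpM2l // ltW.
  apply: (@le_trans _ _ (3 / 2 * (beta * fstar) / delta * m%:R)).
    by rewrite ler_wpM2r ?ler0n // ler_wpM2r // invr_ge0 ltW.
  have -> : 3 / 2 * (beta * fstar) / delta * m%:R =
      eps * (3 * m%:R * gamma / c * beta ^+ r.+1).
    rewrite /eps /delta exprS; field.
    by rewrite !lt0r_neq0 // exprn_gt0.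
  rewrite ler_wpM2l ?(ltW eps0) // ler_wpM2r ?(le_trans _ bp1) //.
  by rewrite /C1 lerDl.
have fN : qmodule_deg g (n * N + K0 + D) f.
  apply: (@putinar_bounded _ _ _ g 1 gamma A eps delta lambda 1 K0 D e K) => //.
  - by apply: l1_boundW fA => //; apply: leq_trans DK.
  - by rewrite DE; apply: deg_le.
  - by move=> z z1; apply: l1_bound_eval fA z1.
  - move=> z z1; case: (cP f d A fstar beta fA b1 f0 fS dA z z1) => [|[j gj]].
      by left.
    right; exists j; rewrite mevalZ /delta -mulrN ler_wpM2l // invr_ge0.
    exact: ltW.
  - exact: ltW.
  - exact: ltW.
  - exact: ltW.
  - by rewrite /lambda divfK // lt0r_neq0.
  - by rewrite /N !muln_gt0 !expn_gt0 D0 K0'.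
  - rewrite /N; do 3![apply: leq_trans (leq_pmulr _ _); rewrite ?expn_gt0 //].
    by rewrite expnS expn1 mulnCA leq_pmulr // muln_gt0.
  - rewrite mulr1; have -> : 1 + 1 = 2 :> R by [].
    have AK : A <= fstar * K%:R.
      by rewrite mulrC (le_trans Ab) // ler_wpM2r ?(ltW f0) //; lra.
    have h4 : (2 : R) ^+ (2 * K) = 4 ^+ K by rewrite exprM; congr (_ ^+ _); ring.
    have h41 : 1 <= (4 : R) ^+ K by rewrite exprn_ege1 //; lra.
    have h5 : A + lambda * (m%:R * 2 ^+ (2 * K)) <= 2 * fstar * K%:R * 4 ^+ K.
      rewrite h4 mulrA.
      have : lambda * m%:R * 4 ^+ K <= eps * K%:R * 4 ^+ K.
        by rewrite ler_wpM2r // (le_trans _ h41).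
      have : fstar * K%:R * 1 <= fstar * K%:R * 4 ^+ K.
        by rewrite ler_wpM2l // mulr_ge0 ?ler0n // ltW.
      have : 0 <= fstar * K%:R * 4 ^+ K.
        by rewrite !mulr_ge0 ?ler0n ?(ltW f0) // (le_trans _ h41).
      by rewrite /eps; lra.
    have -> : eps / 2 * N%:R =
        D%:R ^+ 2 * (2 * fstar * K%:R * 4 ^+ K * 3 ^+ D).
      by rewrite /eps /N !natrM !natrX; field.
    rewrite ler_wpM2l ?sqr_ge0 // mulr1 ler_wpM2r // exprn_ge0 //; lra.
apply: qmodule_deg_truncated fN.
apply: (@le_trans _ _ (M * 2 ^ ((4 * E + 3) * K))%:R).
  by rewrite ler_nat; apply: degree_estimate.
rewrite natrM ler_wpM2l ?ler0n // (le_trans (natr_pow2_le_expR _ _)) //.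
rewrite ler_expR natrM -mulrA ler_wpM2l ?ler0n //.
by rewrite (le_trans Kx) // mulrDl mul1r lerD2l.
Qed.

End DegreeBound.

(** * The theorem *)

Theorem theorem6 (R : realType) (n m : nat) (n_ge1 : (1 <= n)%N)
    (g : m.-tuple {mpoly R[n]})
    (g_arch : archimedean g)
    (S_nonempty : Sset g !=set0)
    (S_cube : Sset g `<=` [set x | forall i : 'I_n, -1 < x i < 1]) :
  exists c : R, 0 < c /\
    forall (f : {mpoly R[n]}) (d : nat) (fstar : R),
      msize f = d.+1 ->
      is_minimum [set f.@[x] | x in Sset g] fstar ->
      0 < fstar ->
      truncated_quadratic_module g
        (c * expR ((d%:R ^+ 2 * n%:R ^+ d * (mpoly_norm f / fstar)) `^ c)) f.
Proof.
have [C [F [p [C0 F0 main]]]] := putinar_degree g_arch S_cube.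
have [c [c0 cP]] := growth p C0 (mulr_ge0 F0 (exprn_ge0 p (ler0n R 2))).
exists c; split=> // f d fstar fd [[y Sy fy] flb] f0.
have fS x : Sset g x -> fstar <= f.@[x] by move=> Sx; apply: flb; exists x.
have y1 i : `|y i| <= 1 by rewrite ler_norml; have := S_cube y Sy i; lra.
pose B : R := d%:R ^+ 2 * n%:R ^+ d * (mpoly_norm f / fstar).
have nf := mpoly_norm_ge0 f.
have B0 : 0 <= B.
  by rewrite mulr_ge0 ?divr_ge0 ?mulr_ge0 ?exprn_ge0 ?ler0n // ltW.
have [d0|d0] := posnP d.
  have [a fC] : exists a : R, f = a%:MP.
    by exists f@_0%MM; apply: msize1_polyC; rewrite fd d0.
  apply: (@qmodule_deg_truncated _ _ _ _ 0).
    by rewrite mulr_ge0 ?expR_ge0 // ltW.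
  apply: qmodule_deg_sos; last by rewrite fd d0.
  by rewrite fC; apply: sosC; have := fS y Sy; rewrite fC mevalC; lra.
pose A : R := d.+1%:R * n%:R ^+ d * mpoly_norm f.
have fA : l1_bound d A f by apply: l1_bound_norm.
have d1 : 1 <= d%:R :> R by rewrite ler1n.
have fA' : fstar <= A.
  rewrite -fy (le_trans (ler_norm _)) //; apply: l1_bound_eval fA y1.
have dA : d%:R * A <= 2 * B * fstar.
  have -> : 2 * B * fstar = d%:R * (2 * d%:R * n%:R ^+ d * mpoly_norm f).
    by rewrite /B; field; rewrite lt0r_neq0.
  rewrite ler_wpM2l // ler_wpM2r // ler_wpM2r ?exprn_ge0 ?ler0n //.
  by rewrite -natr1; lra.
have A0 : 0 < A by rewrite (lt_le_trans f0).
have dB : d%:R <= 2 * B.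
  rewrite -(ler_pM2r f0) (le_trans _ dA) // ler_wpM2l //.
have AB : A <= 2 * B * fstar.
  by apply: le_trans dA; rewrite ler_peMl // ltW.
have := main f d A fstar (2 * B) fA (le_trans d1 dB) f0 fA' fS AB dB dA.
move=> [s [s1 s2 s3]]; exists s; split=> // i.
case: (s2 i) => [->|h]; [by left | right]; apply: le_trans h _.
rewrite -/B; have := cP B B0; move: B {B0 dA dB AB s2} => b.
by rewrite exprMn mulrA.
Qed.
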